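(* Let $(X,d)$ be a Polish metric space, $(\Theta,\Xi)$ a measurable space, $\{\vartheta_x: x\in X\}$ a family of probability measures on $\Theta$, and $\{S_\theta:\theta\in\Theta\}$ a family of continuous maps $S_\theta:X\to X$ such that $(\theta,x)\mapsto S_\theta(x)$ is product measurable. Assume: (B1) There exists $\alpha\in(0,1)$ such that $\int_\Theta d(S_\theta(x),S_\theta(y))\,\vartheta_x(d\theta)\le\alpha\, d(x,y)$ for all $x,y\in X$. (B2) There exists $\bar x\in X$ such that $c:=\sup_{x\in X}\int_\Theta d(S_\theta(\bar x),\bar x)\,\vartheta_x(d\theta)<\infty$. (B3) There exist $l>0$ and $\nu\in(0,1]$ such that $\|\vartheta_x-\vartheta_y\|\le l\,d(x,y)^\nu$ for all $x,y\in X$, where $\|\cdot\|$ is the total variation norm. (B4) There exists $\delta>0$ such that, with $\alpha$ from (B1), $(\vartheta_x\wedge\vartheta_y)(\{\theta\in\Theta: d(S_\theta(x),S_\theta(y))\le\alpha\, d(x,y)\})>\delta$ for all $x,y\in X$. Then the operator $P:B_b(X)\to B_b(X)$, $$Pf(x)=\int_\Theta f(S_\theta(x))\,\vartheta_x(d\theta),$$ possesses a unique invariant measure $\mu_*\in\mathcal M_1^1(X)$, which is attractive in $\mathcal M_1(X)$. Moreover, there exist $q\in(0,1)$ and $C>0$ such that $$\|P^{*n}\mu-\mu_*\|_{FM}\le q^nC\Big(1+\int_X d(\bar x,x)\,\mu(dx)\Big)\qquad\text{for }\mu\in\mathcal M_1^1(X),\ n\in\mathbb N.$$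
   Context: $B_b(X)$ is the space of bounded Borel measurable real functions on $X$, $C_b(X)$ its subspace of bounded continuous functions. $\mathcal M_{fin}(X)$ is the set of finite Borel measures, $\mathcal M_1(X)$ the set of Borel probability measures on $X$, and $\mathcal M_1^1(X)=\{\mu\in\mathcal M_1(X):\int_X d(\bar x,x)\,\mu(dx)<\infty\}$ (independent of the choice of $\bar x\in X$). $\vartheta_x\wedge\vartheta_y$ denotes the greatest lower bound of $\vartheta_x$ and $\vartheta_y$ in the lattice of finite measures on $(\Theta,\Xi)$. The dual operator is $P^*\mu(A)=\int_X\int_\Theta\mathbf 1_A(S_\theta(x))\,\vartheta_x(d\theta)\,\mu(dx)$ for $\mu\in\mathcal M_{fin}(X)$ and Borel $A\subset X$. A measure $\mu_*\in\mathcal M_1(X)$ is invariant for $P$ if $P^*\mu_*=\mu_*$. It is attractive in $\mathcal M_1(X)$ if $\lim_{n\to\infty}\int_X P^nf\,d\mu=\int_X f\,d\mu_*$ for all $f\in C_b(X)$ and $\mu\in\mathcal M_1(X)$. Fortet–Mourier metric: $\|\mu_1-\mu_2\|_{FM}=\sup\{|\int_X f\,d(\mu_1-\mu_2)|: f\in\mathcal F\}$, where $\mathcal F=\{f\in C_b(X): |f(x)-f(y)|\le d(x,y)\text{ and }|f(x)|\le1\text{ for all }x,y\in X\}$. *)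

(* Defs.v *)
From HB Require Import structures.
From mathcomp Require Import all_boot all_order all_algebra.
From mathcomp Require Import all_classical all_reals all_analysis.

Set Implicit Arguments.
Unset Strict Implicit.
Unset Printing Implicit Defensive.

Import Order.TTheory GRing.Theory Num.Theory.
Import numFieldNormedType.Exports.

Local Open Scope classical_set_scope.
Local Open Scope ring_scope.

#[short(type="completeMetricType")]
HB.structure Definition CompleteMetric (R : numDomainType) :=
  {T of Metric R T & Complete T}.

Definition separable_space (X : topologicalType) : Prop :=
  exists2 D : set X, countable D & dense D.

Notation borel X := (g_sigma_algebraType (@open X)).

Section measures_on_a_measurable_space.
Context {d : measure_display} {T : measurableType d} {R : realType}.
Local Open Scope ereal_scope.

(* |nu|(T) for the variation |nu| of nu; the choice of the Hahn decomposition
   is irrelevant. *)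
Definition tv_norm (nu : {charge set T -> \bar R}) : \bar R :=
  let hP := cid (Hahn_decomposition nu) in
  let hN := cid (projT2 hP) in
  charge_variation (projT2 hN) setT.

Definition charge_diff (mu nu : {finite_measure set T -> \bar R}) :
    {charge set T -> \bar R} :=
  cadd (charge_of_finite_measure mu) (copp (charge_of_finite_measure nu)).

Definition measure_le (mu nu : set T -> \bar R) : Prop :=
  forall A, measurable A -> mu A <= nu A.

(* The values of a measure are only relevant on measurable sets, so the
   greatest lower bound is unique as a function on measurable sets, not as a
   term. *)
Definition is_measure_meet (mu nu lam : {finite_measure set T -> \bar R}) :
    Prop :=
  [/\ measure_le lam mu, measure_le lam nu &
      forall kap : {finite_measure set T -> \bar R},
        measure_le kap mu -> measure_le kap nu -> measure_le kap lam].

End measures_on_a_measurable_space.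

Section function_spaces_and_metrics.
Context {R : realType} {X : completeMetricType R}.

Definition Bb : set (X -> R) :=
  [set f | measurable_fun [set: borel X] (f : borel X -> R) /\ bounded_fun f].

Definition Cb : set (X -> R) := [set f | continuous f /\ bounded_fun f].

Definition M11 : set (probability (borel X) R) :=
  [set mu : probability (borel X) R | exists x0 : X, (\int[mu]_x (mdist x0 x)%:E < +oo)%E].

Definition FM_class : set (X -> R) :=
  [set f | Cb f /\ forall x y, `|f x - f y| <= mdist x y /\ `|f x| <= 1].

Definition FM_dist (mu1 mu2 : set (borel X) -> \bar R) : \bar R :=
  ereal_sup
    [set `| \int[mu1]_x (f x)%:E - \int[mu2]_x (f x)%:E |%E | f in FM_class].

End function_spaces_and_metrics.

Section random_iteration.
Context {R : realType} {X : completeMetricType R}.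
Context {d : measure_display} {Theta : measurableType d}.
Variables (vartheta : X -> probability Theta R) (S : Theta -> X -> X).

Definition P_op (f : X -> R) (x : X) : R :=
  \int[vartheta x]_theta (f (S theta x)).

(* Stated on set functions so that it can be iterated without first proving
   that it sends measures to measures. *)
Definition P_dual (mu : set (borel X) -> \bar R) (A : set (borel X)) : \bar R :=
  (\int[mu]_x \int[vartheta x]_theta (\1_A (S theta x))%:E)%E.

Definition invariant_measure (mu : probability (borel X) R) : Prop :=
  forall A : set (borel X), measurable A -> P_dual mu A = mu A.

Definition attractive_measure (mu_star : probability (borel X) R) : Prop :=
  forall (f : X -> R) (mu : probability (borel X) R), Cb f ->
    \int[mu]_x (iter n P_op f x) @[n --> \oo] --> \int[mu_star]_x (f x).

End random_iteration.

(* Main.v *)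
From HB Require Import structures.
Require Import Defs.
From mathcomp Require Import all_boot all_order all_algebra.
From mathcomp Require Import all_classical all_reals all_analysis.
From mathcomp Require Import measurable_realfun giry lra ring.

Set Implicit Arguments.
Unset Strict Implicit.
Unset Printing Implicit Defensive.

Import Order.TTheory GRing.Theory Num.Theory.
Import numFieldNormedType.Exports.

Local Open Scope classical_set_scope.
Local Open Scope ring_scope.

(* Let phi(x, y) = 1 - (1 + K d(x, y)^nu)^-p, W(x, y) = 1 + eta (d(xbar, x) +
   d(xbar, y)) and rho = sqrt (phi W). For p, K large and eta small, P shrinks
   by a factor q < 1 the Lipschitz constant with respect to rho. Indeed (B1),
   (B3) and (B4), applied to the common part of vartheta_x and vartheta_y,
   shrink phi when d(xbar, x) + d(xbar, y) is bounded, the drift given by (B1)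
   and (B2) shrinks W when that sum is large, and AM-GM decouples the square
   root. Bounded Lipschitz functions are rho-Lipschitz,
   so P^n f converges geometrically to a constant L f. The functional L is
   represented by a probability measure through the Daniell outer measure
   A |-> inf { sum_i L f_i : f_i >= 0, sum_i f_i >= 1_A }; continuity of L
   along decreasing sequences follows from equi-Lipschitz continuity and
   completeness, as in Ulam's tightness theorem. *)

(** * Bounded measurable functions and their integrals *)

Section bounded_measurable.
Context {d : measure_display} {T : measurableType d} {R : realType}.
Implicit Types f g : T -> R.

(** The obstacle is that (B1) averages over vartheta_x alone, while P f(x) - P f(y) involves two
    measures: replacing vartheta_x by vartheta_y costs up to l d^nu, which need not be small against
    d. So d is replaced by phi, which is of order K d^nu near 0, and K makes this cost a small
    fraction of phi. As phi <= 1, uncoupled mass costs at most 1, but for the same reason the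
    contraction rate of phi degenerates as d grows, and the weight W has to compensate far from
    xbar. Under the square root the factors of phi and W are averaged, so W may grow a little where
    phi shrinks, and phi may stagnate where W shrinks; this is the type of distance used in weak
    forms of Harris' theorem. After AM-GM, W contributes only a sum of functions of one point, so a
    joint law is needed for phi alone, and only on the common part. Since X need not be locally
    compact, positivity of L does not by itself give a measure. What helps is that P^n f -> L f at a
    rate depending on f only through its bound and Lipschitz constant. *)

Definition bmeas f := measurable_fun [set: T] f /\ exists M, forall x, `|f x| <= M.

Lemma bmeas_integrable (mu : {finite_measure set T -> \bar R}) f :
  bmeas f -> mu.-integrable [set: T] (EFin \o f).
Proof.
move=> [mf [M fM]]; apply: measurable_bounded_integrable => //.
  by rewrite ltey_eq fin_num_measure.
exists M; split; first exact: num_real.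
by move=> N MN x _ /=; rewrite (le_trans (fM x))// ltW.
Qed.

Lemma bmeas_cst c : bmeas (cst c).
Proof. by split; [exact: measurable_cst|exists `|c|]. Qed.

Lemma bmeasD f g : bmeas f -> bmeas g -> bmeas (fun x => f x + g x).
Proof.
move=> [mf [M fM]] [mg [N gN]]; split; first exact: measurable_funD.
exists (M + N) => x; rewrite (le_trans (ler_normD _ _))// lerD//.
Qed.

Lemma bmeasM f g : bmeas f -> bmeas g -> bmeas (fun x => f x * g x).
Proof.
move=> [mf [M fM]] [mg [N gN]]; split; first exact: measurable_funM.
by exists (M * N) => x; rewrite normrM ler_pM.
Qed.

Lemma Rintegral_probability_cst (P : probability T R) c : \int[P]_x c = c.
Proof. by rewrite Rintegral_cst// -[RHS]mulr1; congr (_ * _); exact: (congr1 fine (probability_setT P)). Qed.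

Lemma Rintegral_EFin (mu : {finite_measure set T -> \bar R}) f :
  bmeas f -> (\int[mu]_x (f x)%:E = (\int[mu]_x f x)%:E)%E.
Proof.
move=> bf; rewrite /Rintegral fineK// integrable_fin_num//.
exact: bmeas_integrable.
Qed.

Lemma le_Rintegral_bmeas (mu : {finite_measure set T -> \bar R}) f g :
  bmeas f -> bmeas g -> (forall x, f x <= g x) ->
  \int[mu]_x f x <= \int[mu]_x g x.
Proof. by move=> bf bg fg; apply: le_Rintegral => //; exact: bmeas_integrable. Qed.

Lemma bmeas_sum n (F : nat -> T -> R) : (forall i, bmeas (F i)) ->
  bmeas (fun x => \sum_(i < n) F i x).
Proof.
move=> bF; elim: n => [|n ih].
  by under eq_fun do rewrite big_ord0; exact: bmeas_cst.
by under eq_fun do rewrite big_ord_recr/=; exact: bmeasD.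
Qed.

Lemma bmeas_indic (A : set T) : measurable A -> bmeas (\1_A : T -> R).
Proof.
move=> mA; split; first exact: measurable_indic.
by exists 1 => x; rewrite indicE; case: (_ \in _); rewrite ?normr1 ?normr0.
Qed.

Lemma RintegralD_bmeas (mu : {finite_measure set T -> \bar R}) f g :
  bmeas f -> bmeas g ->
  \int[mu]_x (f x + g x) = \int[mu]_x f x + \int[mu]_x g x.
Proof. by move=> bf bg; apply: RintegralD => //; exact: bmeas_integrable. Qed.

Lemma RintegralZl_bmeas (mu : {finite_measure set T -> \bar R}) c f :
  bmeas f -> \int[mu]_x (c * f x) = c * \int[mu]_x f x.
Proof. by move=> bf; apply: RintegralZl => //; exact: bmeas_integrable. Qed.

Lemma Rintegral_sum_bmeas (mu : {finite_measure set T -> \bar R}) n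
    (F : nat -> T -> R) : (forall i, bmeas (F i)) ->
  \int[mu]_x (\sum_(i < n) F i x) = \sum_(i < n) \int[mu]_x F i x.
Proof.
move=> bF; elim: n => [|n ih].
  under eq_Rintegral do rewrite big_ord0.
  by rewrite big_ord0 Rintegral_cst// mul0r.
under eq_Rintegral do rewrite big_ord_recr/=.
by rewrite RintegralD_bmeas ?ih ?big_ord_recr//; exact: bmeas_sum.
Qed.

Lemma Rintegral_indic (mu : {finite_measure set T -> \bar R}) (A : set T) :
  measurable A -> \int[mu]_x (\1_A x : R) = fine (mu A).
Proof. by move=> mA; rewrite /Rintegral integral_indic// setIT. Qed.

End bounded_measurable.

(** * Borel measurability from continuity *)

Section borel_functions.
Context {R : realType} {X : completeMetricType R}.

Lemma continuous_borel_measurable (f : X -> R) : continuous f ->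
  measurable_fun [set: borel X] (f : borel X -> R).
Proof.
move=> cf; apply: (measurability _ (RGenOpens.measurableE R)).
move=> _ [_ [a [b ->] <-]]; rewrite setTI.
apply: sub_sigma_algebra; apply: open_comp; last exact: interval_open.
by move=> x _; exact: cf.
Qed.

Lemma open_borel_measurable (U : set X) : open U -> measurable (U : set (borel X)).
Proof. by move=> oU; exact: sub_sigma_algebra. Qed.

End borel_functions.

(** * Real inequalities behind the contraction *)

Section real_inequalities.
Context {R : realType}.

(** Concavity of the power: the right side is its tangent at 1. *)
Lemma powR_le_tangent (r nu : R) : 0 <= r -> 0 < nu <= 1 ->
  r `^ nu <= 1 + nu * (r - 1).
Proof.
move=> r0 /andP[nu0 nu1]; have [->|rn0] := eqVneq r 0.
  by rewrite powR0 ?gt_eqF//; lra.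
have rpos : 0 < r by rewrite lt_neqAle eq_sym rn0.
have -> : r `^ nu = expR (nu * ln r) by rewrite /powR (negbTE rn0).
rewrite -{2}(lnK rpos); set a := ln r; set z := nu * a.
(* Tangent of exp at z, evaluated at a and, in [h0], at 0. With weights nu and 1 - nu the slopes
   cancel because z = nu a. *)
have h1 : expR z * (1 + (a - z)) <= expR a.
  by rewrite -[X in _ <= expR X](subrKC z a) expRD ler_pM2l ?expR_gt0// expR_ge1Dx.
have h0 : expR z * (1 + - z) <= 1.
  by rewrite -[leRHS](expRxMexpNx_1 z) ler_pM2l ?expR_gt0// expR_ge1Dx.
have : nu * (expR z * (1 + (a - z))) + (1 - nu) * (expR z * (1 + - z)) <=
    nu * expR a + (1 - nu) * 1.
  by rewrite lerD// ler_wpM2l//; lra.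
rewrite (_ : nu * (expR z * (1 + (a - z))) + (1 - nu) * (expR z * (1 + - z)) =
  expR z); last by rewrite /z; ring.
lra.
Qed.

Lemma bernoulli (y : R) n : 0 <= y -> 1 + n%:R * (y - 1) <= y ^+ n.
Proof.
move=> y0; elim: n => [|n ih]; first by rewrite expr0 mul0r addr0.
rewrite exprS (le_trans _ (ler_wpM2l y0 ih))// -natr1.
have := mulr_ge0 (ler0n R n) (sqr_ge0 (y - 1)); lra.
Qed.

(** This is 1 - phi as a function of u = K d^nu. Being nonnegative, it can be bounded below on the
    common part alone. If J is its integral there, then 1 - J is the cost of phi with all uncoupled
    mass charged 1. *)
Definition decay (p : nat) (u : R) : R := (1 + u)^-1 ^+ p.

Lemma decay_gt0 p u : 0 <= u -> 0 < decay p u.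
Proof. by move=> u0; rewrite exprn_gt0// invr_gt0 ltr_pwDl. Qed.

Lemma decay0 p : decay p 0 = 1.
Proof. by rewrite /decay addr0 invr1 expr1n. Qed.

Lemma le_decay p s t : 0 <= s -> s <= t -> decay p t <= decay p s.
Proof.
move=> s0 st; have t0 := le_trans s0 st.
by rewrite lerXn2r ?nnegrE ?invr_ge0 ?addr_ge0// lef_pV2 ?posrE ?ltr_pwDl// lerD2l.
Qed.

Lemma decay_le1 p u : 0 <= u -> decay p u <= 1.
Proof. by move=> u0; rewrite -(decay0 p) le_decay. Qed.

Lemma decay_lt1 p u : 0 < u -> decay p.+1 u < 1.
Proof.
by move=> u0; rewrite exprn_ilt1 ?invr_ge0 ?addr_ge0 ?(ltW u0)// invf_lt1 ?ltrDl// ltr_pwDl// ltW.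
Qed.

(** Convexity: the left side is the tangent at t, and Bernoulli's inequality for (1 + t) / (1 + s)
    places it below the curve. *)
Lemma decay_tangent p s t : 0 <= s -> 0 <= t ->
  decay p t * (1 - p%:R * (s - t) / (1 + t)) <= decay p s.
Proof.
move=> s0 t0; have s1 : 0 < 1 + s by lra.
have t1 : 0 < 1 + t by lra.
pose y := (1 + t) / (1 + s).
have y0 : 0 <= y by rewrite divr_ge0// ltW.
have -> : decay p s = decay p t * y ^+ p.
  rewrite /decay -exprMn; congr (_ ^+ _).
  by rewrite /y mulrA mulVf ?mul1r// gt_eqF.
rewrite ler_wpM2l ?(ltW (decay_gt0 _ _))// (le_trans _ (bernoulli _ y0))//.
rewrite lerD2l -mulrA -mulrN ler_wpM2l// -subr_ge0.
have -> : y - 1 - - ((s - t) / (1 + t)) = (s - t) ^+ 2 / ((1 + s) * (1 + t)).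
  by rewrite /y; field; rewrite !gt_eqF.
by rewrite divr_ge0 ?sqr_ge0// mulr_ge0 ?(ltW s1) ?(ltW t1).
Qed.

(** Bernoulli again. In [decay_jensen] it ensures that missing mass costs at most its own size. *)
Lemma decay_mul_le1 p t c : 0 <= t -> 0 <= c -> c <= p%:R * t ->
  decay p t * (1 + c) <= 1.
Proof.
move=> t0 c0 cp; have t1 : 0 < 1 + t by lra.
rewrite /decay exprVn ler_pdivrMl ?exprn_gt0// mulr1.
rewrite (le_trans _ (bernoulli _ (ltW t1)))// addrAC subrr add0r.
by rewrite lerD2l.
Qed.

(* [p] makes the polynomial decay beat the coupling probability [delta] when
   [u >= 1]; a large [K] makes the uncoupled mass, at most [l / K * u],
   negligible when [u <= 1]. *)
Lemma decay_contraction (beta l delta : R) : 0 < beta < 1 -> 0 < l -> 0 < delta ->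
  exists (p : nat) (K k : R), [/\ 1 <= K, 0 < k < 1 &
  forall u J, 0 <= u -> J <= 1 ->
    decay p.+1 (beta * u) - l / K * u <= J -> delta * decay p.+1 (beta * u) <= J ->
    1 - J <= (1 - decay p.+1 u) * (1 - Num.min (decay p.+1 u) k)].
Proof.
move=> /andP[b0 b1] l0 d0.
(* For u >= 1 the ratio (1 + beta u) / (1 + u) is at most g, so p is chosen to make g^(p+1) beat
   delta / 2. *)
pose g : R := (1 + beta) / 2.
have g01 : 0 < g < 1 by apply/andP; rewrite /g; split; lra.
have [p gp] : exists p, g ^+ p.+1 <= delta / 2.
  have : g ^+ n @[n --> \oo] --> (0 : R).
    by apply: cvg_expr; case/andP: g01 => ? ?; rewrite ger0_norm// ltW.
  have d2 : 0 < delta / 2 by lra.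
  move=> /cvgrPdist_le/(_ _ d2)[n _ nP]; exists n.
  have := nP n.+1 (leqnSn n); rewrite /= sub0r normrN ger0_norm// exprn_ge0//.
  by case/andP: g01 => /ltW.
set w := decay p.+1.
(* For u <= 1 the tangent at u gives decay(beta u) - decay(u) >= c1 u. The exponent p + 2 comes from
   the extra factor 1 / (1 + u) of the slope, and 2 from 1 + u <= 2. *)
pose c1 := p.+1%:R * (1 - beta) * 2^-1 ^+ p.+2.
have c10 : 0 < c1.
  by rewrite /c1 mulr_gt0 ?exprn_gt0 ?invr_gt0// mulr_gt0 ?ltr0n ?subr_gt0.
(* Half of the gain c1 u pays for the uncoupled mass l / K u. The other half becomes a relative gain
   k through 1 - decay(u) <= (p + 1) u. *)
pose k := c1 / (2 * p.+1%:R).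
have kE : k = (1 - beta) * 2^-1 ^+ p.+2 / 2.
  by rewrite /k /c1; field; rewrite ?pnatr_eq0.
have k0 : 0 < k by rewrite /k divr_gt0// mulr_gt0 ?ltr0n.
have k1 : k < 1.
  have : 2^-1 ^+ p.+2 <= 1 :> R by rewrite exprn_ile1// invf_le1// ler1n.
  have : 0 < 2^-1 ^+ p.+2 :> R by rewrite exprn_gt0.
  by rewrite kE; move: (2^-1 ^+ p.+2) => e e0 e1; nra.
exists p, (Num.max 1 (2 * l / c1)), k.
set K := Num.max _ _.
have K1 : 1 <= K by rewrite le_max lexx.
have lK : l / K <= c1 / 2.
  rewrite ler_pdivrMr ?(lt_le_trans ltr01)//.
  have : 2 * l / c1 <= K by rewrite le_max lexx orbT.
  by rewrite ler_pdivrMr// => ?; lra.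
split=> //; first by rewrite k0.
move=> u J u0 J1 JK Jd.
have w0 := decay_gt0 p.+1 u0; have w1 := decay_le1 p.+1 u0.
rewrite -/w in w0 w1 JK Jd *.
have [u1|u1] := leP u 1.
  have bu0 : 0 <= beta * u by rewrite mulr_ge0// ltW.
  have T := decay_tangent p.+1 bu0 u0; rewrite -/w in T.
  have wb : w u * (p.+1%:R * ((1 - beta) * u) / (1 + u)) >= c1 * u.
    have -> : w u * (p.+1%:R * ((1 - beta) * u) / (1 + u)) =
        p.+1%:R * (1 - beta) * u * ((1 + u)^-1 ^+ p.+2).
      by rewrite /w /decay [in RHS]exprS; ring.
    rewrite /c1 mulrAC ler_wpM2l//.
      by rewrite !mulr_ge0// subr_ge0 ltW.
    rewrite lerXn2r ?nnegrE ?invr_ge0 ?addr_ge0//.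
    by rewrite lef_pV2 ?posrE//; lra.
  have wu : 1 - w u <= p.+1%:R * u.
    have := decay_tangent p.+1 u0 (lexx 0); rewrite decay0 subr0 addr0 divr1 mul1r -/w.
    lra.
  have ku : k * (1 - w u) <= c1 / 2 * u.
    rewrite (le_trans (ler_wpM2l (ltW k0) wu))// /k.
    have n0 : p.+1%:R != 0 :> R by rewrite pnatr_eq0.
    have E (a n v : R) : n != 0 -> a / (2 * n) * (n * v) = a / 2 * v by move=> ?; field.
    by rewrite E.
  have lu : l / K * u <= c1 / 2 * u by rewrite ler_wpM2r.
  have mk : Num.min (w u) k * (1 - w u) <= k * (1 - w u).
    by rewrite ler_wpM2r ?subr_ge0// ge_min lexx orbT.
  have T' : w u + w u * (p.+1%:R * ((1 - beta) * u) / (1 + u)) <= w (beta * u).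
    rewrite (le_trans _ T)//.
    have E (a n v : R) : 1 + v != 0 ->
        a + a * (n * ((1 - beta) * v) / (1 + v)) =
        a * (1 - n * (beta * v - v) / (1 + v)) by move=> ?; field.
    by rewrite E// gt_eqF//; lra.
  lra.
(* For u > 1 this gives J >= 2 w, and 1 - 2 w <= (1 - w)^2 is a contraction by 1 - w. *)
have w2 : 2 * w u <= delta * w (beta * u).
  have bu0 : 0 <= beta * u by rewrite mulr_ge0// ltW.
  have : w u <= g ^+ p.+1 * w (beta * u).
    rewrite /w /decay -exprMn lerXn2r ?nnegrE ?invr_ge0 ?mulr_ge0 ?invr_ge0//; try lra.
    rewrite ler_pdivlMr; last lra.
    rewrite mulrC ler_pdivrMr; last lra.
    by rewrite /g; nra.
  have wb0 : 0 <= w (beta * u) by rewrite ltW// decay_gt0.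
  move=> /le_trans/(_ (ler_wpM2r wb0 gp)); lra.
have mw : Num.min (w u) k * (1 - w u) <= w u * (1 - w u).
  by rewrite ler_wpM2r ?subr_ge0// ge_min lexx.
have := sqr_ge0 (w u); nra.
Qed.

Lemma sqrt_amgm (a b s : R) : 0 <= a -> 0 <= b -> 0 < s ->
  Num.sqrt (a * b) <= (s * a + s^-1 * b) / 2.
Proof.
move=> a0 b0 s0; have sb0 : 0 <= s^-1 * b by rewrite mulr_ge0// invr_ge0 ltW.
have sa0 : 0 <= s * a by rewrite mulr_ge0// ltW.
have -> : a * b = (s * a) * (s^-1 * b) by field; rewrite gt_eqF.
move: (s * a) (s^-1 * b) sa0 sb0 => x y x0 y0.
rewrite -[leRHS]ger0_norm ?divr_ge0 ?addr_ge0// -sqrtr_sqr ler_sqrt ?sqr_ge0//.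
by have := sqr_ge0 (x - y); lra.
Qed.

(** The final rate is the mean of a factor for phi and a factor for W. Far away phi is only known
    not to grow, so W must shrink by 2q - 1; nearby phi shrinks by 1 - k, and W is allowed the
    factor 2q - 1 + k, which may exceed 1. *)
Lemma drift_rates (alpha c k R0 : R) : 0 < alpha < 1 -> 0 <= c -> 0 < k < 1 ->
  0 < R0 -> 4 * c <= (1 - alpha) * R0 ->
  exists eta q : R, [/\ 0 < eta, 0 < q < 1,
    forall v, R0 <= v ->
      1 + eta * (alpha * v + 2 * c) <= (2 * q - 1) * (1 + eta * v) &
    forall v, 0 <= v ->
      1 + eta * (alpha * v + 2 * c) <= (2 * q - 1 + k) * (1 + eta * v)].
Proof.
move=> /andP[a0 a1] c0 /andP[k0 k1] R0_gt0 cR0.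
(* Small enough that the additive drift 2 c eta is at most k / 2. *)
pose eta := k / (4 * c + 4).
have eta0 : 0 < eta by rewrite divr_gt0// ltr_wpDl// mulr_ge0.
have etac : 2 * c * eta <= k / 2.
  have -> : k / 2 = 2 * (c + 1) * eta by rewrite /eta; field; lra.
  by rewrite -!mulrA ler_wpM2l// ler_wpM2r ?(ltW eta0)// lerDl.
move: eta eta0 etac => eta eta0 etac.
have eR0 : 0 < eta * R0 by rewrite mulr_gt0.
(* For v >= R0 one has alpha v + 2c <= (1 + alpha) / 2 v. The resulting ratio decreases in v, and q2
   is its value at R0. *)
pose q2 := (1 + eta * ((1 + alpha) / 2) * R0) / (1 + eta * R0).
have q2E : q2 * (1 + eta * R0) = 1 + eta * ((1 + alpha) / 2) * R0.
  by rewrite /q2 divfK// gt_eqF// addr_gt0.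
have q21 : q2 < 1.
  by rewrite /q2 ltr_pdivrMr ?addr_gt0//; nra.
have q20 : 0 < q2.
  by rewrite /q2 divr_gt0 ?addr_gt0// mulr_gt0// mulr_gt0//; lra.
(* The two terms ensure 2q - 1 + k >= 1 + k / 2 and 2q - 1 >= q2 respectively. *)
exists eta, (Num.max (1 - k / 4) ((1 + q2) / 2)).
set q := Num.max _ _.
have qk : 1 - k / 4 <= q by rewrite le_max lexx.
have q2q : (1 + q2) / 2 <= q by rewrite le_max lexx orbT.
have q1 : q < 1 by rewrite gt_max; apply/andP; split; lra.
split => // [|v vR0|v v0]; first by apply/andP; split; lra.
  apply: (@le_trans _ _ (q2 * (1 + eta * v))); last first.
    by rewrite ler_wpM2r; nra.
  rewrite -(ler_pM2r (_ : 0 < 1 + eta * R0)) ?addr_gt0// mulrAC q2E.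
  have h1 : 0 <= eta * ((1 - alpha) * (v - R0)).
    by rewrite mulr_ge0 ?(ltW eta0)// mulr_ge0 ?subr_ge0// ltW.
  have h2 : 0 <= (1 + eta * R0) * (eta * ((1 - alpha) * R0 - 4 * c)).
    by rewrite mulr_ge0 ?addr_ge0 ?(ltW eR0)// mulr_ge0 ?(ltW eta0)// subr_ge0.
  have h3 : 0 <= eta * R0 * (eta * ((1 - alpha) * (v - R0))).
    by rewrite mulr_ge0 ?(ltW eR0).
  lra.
apply: (@le_trans _ _ ((1 + k / 2) * (1 + eta * v))); last first.
  by rewrite ler_wpM2r ?addr_ge0 ?mulr_ge0 ?(ltW eta0)//; lra.
have ev : 0 <= eta * v by rewrite mulr_ge0// ltW.
have : 0 <= (1 - alpha) * (eta * v) by rewrite mulr_ge0// subr_ge0 ltW.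
have : 0 <= k / 2 * (eta * v) by rewrite mulr_ge0// divr_ge0// ltW.
lra.
Qed.

End real_inequalities.

(** * Bounded Lipschitz functions *)

Section bounded_lipschitz.
Context {R : realType} {X : completeMetricType R}.
Implicit Types f g : X -> R.

(** A single M serves as bound and as Lipschitz constant. The class is an algebra and a lattice
    containing the constants, as Daniell's construction requires. *)
Definition blip f := exists M : R,
  forall x, `|f x| <= M /\ forall y, `|f x - f y| <= M * mdist x y.

Lemma blip_cst c : blip (cst c).
Proof.
exists `|c| => x; split=> // y.
by rewrite subrr normr0 mulr_ge0// mdist_ge0.
Qed.

Lemma blipD f g : blip f -> blip g -> blip (fun x => f x + g x).
Proof.
move=> [M fM] [N gN]; exists (M + N) => x; split=> [|y].
  by rewrite (le_trans (ler_normD _ _))// lerD// ?(fM x).1 ?(gN x).1.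
rewrite opprD addrACA mulrDl (le_trans (ler_normD _ _))// lerD//.
  exact: (fM x).2.
exact: (gN x).2.
Qed.

Lemma blipM f g : blip f -> blip g -> blip (fun x => f x * g x).
Proof.
move=> [M fM] [N gN]; exists (M * N + M * N) => x.
have M0 : 0 <= M by rewrite (le_trans _ (fM x).1).
have N0 : 0 <= N by rewrite (le_trans _ (gN x).1).
split=> [|y].
  rewrite normrM (le_trans (ler_pM _ _ (fM x).1 (gN x).1))//.
  by rewrite lerDl mulr_ge0.
have -> : f x * g x - f y * g y = f x * (g x - g y) + g y * (f x - f y).
  by ring.
rewrite (le_trans (ler_normD _ _))// !normrM mulrDl lerD//.
  by rewrite -mulrA ler_pM// ?(fM x).1// (gN x).2.
by rewrite [M * N]mulrC -mulrA ler_pM// ?(gN y).1// (fM x).2.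
Qed.

Lemma blipN f : blip f -> blip (fun x => - f x).
Proof.
move=> bf; have := blipM (blip_cst (-1)) bf.
by congr blip; apply/funext => x; rewrite mulN1r.
Qed.

Lemma blipB f g : blip f -> blip g -> blip (fun x => f x - g x).
Proof. by move=> bf bg; apply: blipD => //; exact: blipN. Qed.

Lemma blip_norm f : blip f -> blip (fun x => `|f x|).
Proof.
move=> [M fM]; exists M => x; split=> [|y]; first by rewrite normr_id (fM x).1.
by rewrite (le_trans (ler_dist_dist _ _))// (fM x).2.
Qed.

Lemma blip_max f g : blip f -> blip g -> blip (fun x => Num.max (f x) (g x)).
Proof.
move=> bf bg.
have := blipM (blipD (blipD bf bg) (blip_norm (blipB bf bg))) (blip_cst 2^-1).
by congr blip; apply/funext => x; rewrite maxr_absE.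
Qed.

Lemma blip_min f g : blip f -> blip g -> blip (fun x => Num.min (f x) (g x)).
Proof.
move=> bf bg.
have := blipM (blipB (blipD bf bg) (blip_norm (blipB bf bg))) (blip_cst 2^-1).
by congr blip; apply/funext => x; rewrite minr_absE.
Qed.

Lemma blip_sum (F : nat -> X -> R) n :
  (forall i, blip (F i)) -> blip (fun x => \sum_(i < n) F i x).
Proof.
move=> bF; elim: n => [|n ih].
  by under eq_fun do rewrite big_ord0; exact: blip_cst.
by under eq_fun do rewrite big_ord_recr/=; exact: blipD.
Qed.

Lemma lipschitz_continuous f (M : R) :
  (forall x y, `|f x - f y| <= M * mdist x y) -> continuous f.
Proof.
move=> fM x; apply/cvgrPdist_le => /= e e0.
have M0 : 0 < `|M| + 1 by rewrite ltr_wpDl.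
apply/nbhs_ballP; exists (e / (`|M| + 1)) => /=.
  by rewrite divr_gt0.
move=> y; rewrite ballEmdist /= => xy; rewrite (le_trans (fM x y))//.
rewrite ltr_pdivlMr// in xy.
rewrite (le_trans _ (ltW xy))// mulrC ler_wpM2l ?mdist_ge0//.
by rewrite (le_trans (ler_norm M))// lerDl.
Qed.

Lemma blip_continuous f : blip f -> continuous f.
Proof. by move=> [M fM]; apply: (@lipschitz_continuous _ M) => x; exact: (fM x).2. Qed.

Lemma blip_bounded f : blip f -> exists M, forall x, `|f x| <= M.
Proof. by move=> [M fM]; exists M => x; exact: (fM x).1. Qed.

Lemma blip_bmeas f : blip f -> bmeas (f : borel X -> R).
Proof.
move=> bf; split; last exact: blip_bounded.
by apply: continuous_borel_measurable; exact: blip_continuous.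
Qed.

Lemma mdist_lipschitz (a x y : X) : `|mdist a x - mdist a y| <= mdist x y.
Proof.
rewrite ler_norml; apply/andP; split.
  by rewrite lerBDr addrC lerBDr; exact: metric_triangle.
by rewrite lerBDl [mdist x y]metric_sym; exact: metric_triangle.
Qed.

Lemma truncated_lipschitz_blip (c : R) f : 0 <= c ->
  (forall x y, f x - f y <= c * mdist x y) ->
  (forall x, 0 <= f x) -> blip (fun x => Num.min 1 (f x)).
Proof.
move=> c0 fc f0; exists (1 + c) => x; split=> [|y].
  rewrite ger0_norm; last by rewrite le_min ler01 f0.
  by rewrite ge_min lerDl c0.
have fc' u v : Num.min 1 (f u) - Num.min 1 (f v) <= (1 + c) * mdist u v.
  rewrite mulrDl mul1r lerBDr; have := fc u v; have := mdist_ge0 u v.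
  have := mulr_ge0 c0 (mdist_ge0 u v).
  by case: (leP 1 (f u)) => ?; case: (leP 1 (f v)) => ?; lra.
rewrite ler_norml; apply/andP; split; last exact: fc'.
by rewrite lerNl opprB metric_sym fc'.
Qed.

(** Truncate k times the distance to the complement of U at 1. At each point of U the sequence
    reaches 1 after finitely many steps, so finite sums of increments suffice there. *)
Lemma open_blip_approx (U : set X) : open U -> exists g : nat -> X -> R,
  [/\ forall k, blip (g k), forall k x, 0 <= g k x <= 1,
      forall k x, g k x <= g k.+1 x,
      forall k x, ~ U x -> g k x = 0 &
      forall x, U x -> exists K, forall k, (K <= k)%N -> g k x = 1].
Proof.
move=> oU; have [[z Uz]|UT] := pselect (exists z, ~ U z); last first.
  (* With no point outside U, the distance to the complement would be an infimum over the empty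
     set. *)
  exists (fun _ _ => 1); split => //; first by move=> k; exact: blip_cst.
  - by move=> k x; rewrite ler01 lexx.
  - by move=> k x Ux; exfalso; apply: UT; exists x.
  - by move=> x Ux; exists 0%N.
pose D x := [set mdist x a | a in ~` U].
have D0 x : lbound (D x) 0 by move=> _ [a _ <-]; exact: mdist_ge0.
have hD x : has_inf (D x).
  by split; [exists (mdist x z); exists z | exists 0].
pose p x := inf (D x).
have p0 x : 0 <= p x by apply: lb_le_inf; [exact: (hD x).1|exact: D0].
have plip x y : p x - p y <= mdist x y.
  rewrite lerBlDr -lerBlDl; apply: lb_le_inf; first exact: (hD y).1.
  move=> _ [a Ua <-]; rewrite lerBlDl (@le_trans _ _ (mdist x a))//.
    by apply: ge_inf; [exists 0|exists a].
  exact: metric_triangle.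
exists (fun k x => Num.min 1 (k%:R * p x)); split.
- move=> k; apply: (@truncated_lipschitz_blip k%:R) => //.
  + by move=> x y; rewrite -mulrBr ler_wpM2l.
  + by move=> x; rewrite mulr_ge0.
- by move=> k x; rewrite le_min ler01 mulr_ge0//= ge_min lexx.
- move=> k x; rewrite le_min ge_min lexx/= ge_min.
  by rewrite ler_wpM2r ?orbT// ler_nat.
- move=> k x Ux; suff -> : p x = 0 by rewrite mulr0 min_r.
  apply/eqP; rewrite eq_le p0 andbT; apply: ge_inf; first by exists 0.
  by exists x => //; exact: mdistxx.
- move=> x Ux; have : nbhs x U by exact: open_nbhs_nbhs.
  move=> /nbhs_ballP[e /= e0]; rewrite ballEmdist => eU.
  have pe : e <= p x.
    apply: lb_le_inf; first exact: (hD x).1.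
    by move=> _ [a Ua <-]; rewrite leNgt; apply/negP => ae; apply/Ua/eU.
  exists (Num.truncn e^-1).+1 => k ek; rewrite min_l//.
  rewrite (@le_trans _ _ (k%:R * e))// ?ler_wpM2l//.
  rewrite -ler_pdivrMr// div1r (@le_trans _ _ (Num.truncn e^-1).+1%:R)//.
    by rewrite ltW// truncnS_gt.
  by rewrite ler_nat.
Qed.

End bounded_lipschitz.

(** * Rearrangement of double series *)

Section sums.
Context {R : realType}.

(** The enumeration is fixed before [a], since one rearrangement must serve both the values of the
    functions at every point and their values under L. *)
Lemma nneseries_pairE : exists f : nat -> nat * nat,
  forall a : nat -> nat -> \bar R, (forall i j, 0 <= a i j)%E ->
  (\sum_(i <oo) \sum_(j <oo) a i j = \sum_(n <oo) a (f n).1 (f n).2)%E.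
Proof.
have /card_esym/ppcard_eqP[f] := card_nat2; exists f => a a0.
transitivity (\esum_(i in [set: nat]) \esum_(j in [set: nat]) a i j)%E.
  rewrite nneseries_esumT; last by move=> i; exact: nneseries_ge0.
  by apply: eq_esum => i _; rewrite nneseries_esumT.
rewrite esum_esum// nneseries_esumT//.
rewrite (_ : [set: nat] `*`` _ = [set: nat * nat]); last first.
  by apply/seteqP; split => // -[].
by apply: reindex_esum; exact: bij.
Qed.

End sums.

(** * The Daniell outer measure *)

Section daniell.
Context {R : realType} {X : completeMetricType R}.
Variable L : (X -> R) -> R.
Hypothesis LD : forall f g, blip f -> blip g ->
  L (fun x => f x + g x) = L f + L g.
Hypothesis LZ : forall c f, blip f -> L (fun x => c * f x) = c * L f.
Hypothesis L1 : L (cst 1) = 1.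
Hypothesis L_ge0 : forall f, blip f -> (forall x, 0 <= f x) -> 0 <= L f.
Implicit Types (f g : X -> R) (A : set X).

Lemma functional0 : L (cst 0) = 0.
Proof.
rewrite -[RHS](mul0r (L (cst 0))) -LZ; last exact: blip_cst.
by congr L; apply/funext => x; rewrite mul0r.
Qed.

Lemma functionalB f g : blip f -> blip g -> L (fun x => f x - g x) = L f - L g.
Proof.
move=> bf bg; rewrite LD//; last exact: blipN.
congr (_ + _); rewrite -[RHS]mulN1r -LZ//.
by congr L; apply/funext => x; rewrite mulN1r.
Qed.

Lemma le_functional f g : blip f -> blip g -> (forall x, f x <= g x) -> L f <= L g.
Proof.
move=> bf bg fg; rewrite -subr_ge0 -functionalB// L_ge0//; first exact: blipB.
by move=> x; rewrite subr_ge0.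
Qed.

Lemma functional_sum (F : nat -> X -> R) n : (forall i, blip (F i)) ->
  L (fun x => \sum_(i < n) F i x) = \sum_(i < n) L (F i).
Proof.
move=> bF; elim: n => [|n ih].
  rewrite big_ord0 -[RHS]functional0; congr L; apply/funext => x.
  by rewrite big_ord0.
rewrite big_ord_recr/= -ih -LD//; last exact: blip_sum.
by congr L; apply/funext => x; rewrite big_ord_recr.
Qed.

Definition daniell_cover A (F : nat -> X -> R) :=
  (forall i, blip (F i) /\ forall x, 0 <= F i x) /\
  forall x, A x -> (1 <= \sum_(i <oo) (F i x)%:E)%E.

Definition daniell_outer A : \bar R :=
  ereal_inf [set (\sum_(i <oo) (L (F i))%:E)%E | F in daniell_cover A].

Lemma daniell_cover_ge0 A F : daniell_cover A F -> forall i, (0 <= (L (F i))%:E)%E.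
Proof. by move=> -[FA _] i; rewrite lee_fin; have [] := FA i; exact: L_ge0. Qed.

Lemma daniell_outer_ge0 A : (0 <= daniell_outer A)%E.
Proof.
apply: le_ereal_inf_tmp => _ [F FA <-]; apply: nneseries_ge0 => i _ _.
exact: daniell_cover_ge0 FA i.
Qed.

Lemma daniell_outer0 : daniell_outer set0 = 0%E.
Proof.
apply/eqP; rewrite eq_le daniell_outer_ge0 andbT.
apply: ereal_inf_lbound; exists (fun=> cst 0); last first.
  by rewrite eseries0// => i _ _; rewrite functional0.
by split => // i; split => //; exact: blip_cst.
Qed.

Lemma le_daniell_outer : {homo daniell_outer : A B / A `<=` B >-> (A <= B)%E}.
Proof.
move=> A B AB; apply/ereal_inf_le_tmp => _ [F [F0 FB] <-].
by exists F => //; split => // x /AB; exact: FB.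
Qed.

(** Doubly indexed covers occur twice: as covers of a countable union, and as a cover cut by the
    increments of a sequence growing to the indicator of an open set. *)
Lemma daniell_outer_le2 A (H : nat -> nat -> X -> R) :
  (forall i j, blip (H i j) /\ forall x, 0 <= H i j x) ->
  (forall x, A x -> (1 <= \sum_(i <oo) \sum_(j <oo) (H i j x)%:E)%E) ->
  (daniell_outer A <= \sum_(i <oo) \sum_(j <oo) (L (H i j))%:E)%E.
Proof.
move=> H0 HA.
have LH0 i j : (0 <= (L (H i j))%:E)%E.
  by rewrite lee_fin; have [] := H0 i j; exact: L_ge0.
have [f fE] := @nneseries_pairE R; rewrite fE//.
apply: ereal_inf_lbound; exists (fun n => H (f n).1 (f n).2) => //.
split=> [i|x Ax]; first by split; [exact: (H0 _ _).1|exact: (H0 _ _).2].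
rewrite -(fE (fun i j => (H i j x)%:E)); first exact: HA.
by move=> i j; rewrite lee_fin (H0 i j).2.
Qed.

Lemma daniell_outer_sigma_subadditive : sigma_subadditive daniell_outer.
Proof.
move=> A; have [[i ioo]|] := pselect (exists i, daniell_outer (A i) = +oo%E).
  rewrite (eseries_pinfty _ _ ioo) ?leey// => n _.
  by rewrite -ltNye (lt_le_trans _ (daniell_outer_ge0 _)).
rewrite -forallNE => Aoo; apply/lee_addgt0Pr => e e0.
rewrite (le_trans _ (epsilon_trick _ _ _)) ?(ltW e0)//; last first.
  by move=> n; exact: daniell_outer_ge0.
have [G GP] : {G : nat -> nat -> X -> R & forall n, daniell_cover (A n) (G n) /\
    (\sum_(k <oo) (L (G n k))%:E <=
      daniell_outer (A n) + (e / (2 ^ n.+1)%:R)%:E)%E}.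
  apply: (@choice _ _ (fun n F => daniell_cover (A n) F /\
    (\sum_(k <oo) (L (F k))%:E <=
      daniell_outer (A n) + (e / (2 ^ n.+1)%:R)%:E)%E)) => n.
  have en : 0 < e / (2 ^ n.+1)%:R by rewrite divr_gt0// ltr0n expn_gt0.
  have fin : daniell_outer (A n) \is a fin_num.
    by rewrite ge0_fin_numE ?daniell_outer_ge0// ltey; apply/eqP/Aoo.
  have [_ [F FA <-] FL] := lb_ereal_inf_adherent en fin.
  by exists F; split => //; exact: ltW.
apply: (@le_trans _ _ (\sum_(n <oo) \sum_(k <oo) (L (G n k))%:E)%E).
  apply: daniell_outer_le2 => [i j|x [n _ Anx]]; first exact: ((GP i).1.1 j).
  have G0 i j : (0 <= (G i j x)%:E)%E by rewrite lee_fin ((GP i).1.1 j).2.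
  rewrite (le_trans ((GP n).1.2 _ Anx))//.
  have S0 i : (0 <= \sum_(j <oo) (G i j x)%:E)%E by exact: nneseries_ge0.
  rewrite [leRHS](@nneseriesD1 _ (fun i => \sum_(j <oo) (G i j x)%:E)%E n xpredT)//.
  by rewrite leeDl// nneseries_ge0.
apply: lee_nneseries => [n _|n _]; last exact: (GP n).2.
by move=> _; apply: nneseries_ge0 => k _ _; exact: daniell_cover_ge0 (GP n).1 k.
Qed.

Definition daniell_outer_measure : {outer_measure set X -> \bar R} :=
  HB.pack_for {outer_measure set X -> \bar R} daniell_outer
    (isOuterMeasure.Build R X daniell_outer daniell_outer0 daniell_outer_ge0
      le_daniell_outer daniell_outer_sigma_subadditive).

(** Cut a cover F of A by functions g_n increasing to the indicator of U. The F_i (1 - g_n) cover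
    the part of A outside U for every n, the F_i (g_n - g_(n-1)) together cover the part inside, and
    for each n the two pieces F_i g_n and F_i (1 - g_n) have total cost T. *)
Lemma open_daniell_caratheodory (U : set X) : open U ->
  caratheodory_measurable daniell_outer U.
Proof.
move=> /open_blip_approx[g [bg g01 gS gU0 gU1]].
apply: (@le_caratheodory_measurable _ _ daniell_outer_measure) => A.
apply: le_ereal_inf_tmp => _ [F [F0 FA] <-].
set T := (\sum_(i <oo) (L (F i))%:E)%E.
have [->|Too] := eqVneq T +oo%E; first by rewrite leey.
have LF0 i : (0 <= (L (F i))%:E)%E.
  exact: (@daniell_cover_ge0 A).
(* Starting from g 0 itself makes the first n + 1 increments sum to g n. *)
pose G k x := if k is k'.+1 then g k x - g k' x else g 0%N x.
have bG k : blip (G k) by case: k => [|k] /=; [exact: bg|exact: blipB].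
have G0 k x : 0 <= G k x.
  by case: k => [|k] /=; [case/andP: (g01 0%N x)|rewrite subr_ge0].
have sumG n x : \sum_(k < n.+1) G k x = g n x.
  elim: n => [|n ih]; first by rewrite big_ord1.
  by rewrite big_ord_recr/= ih addrC subrK.
pose H k i x := F i x * G k x.
have bH k i : blip (H k i) by apply: blipM => //; exact: (F0 i).1.
have H0 k i x : 0 <= H k i x by rewrite mulr_ge0// (F0 i).2.
have LH0 k i : (0 <= (L (H k i))%:E)%E by rewrite lee_fin L_ge0.
have bFg n i : blip (fun x => F i x * g n x).
  by apply: blipM => //; exact: (F0 i).1.
have bFg' n i : blip (fun x => F i x * (1 - g n x)).
  apply: blipM; first exact: (F0 i).1.
  by apply: blipB => //; exact: blip_cst.
have Fg'0 n i x : 0 <= F i x * (1 - g n x).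
  by rewrite mulr_ge0 ?(F0 i).2// subr_ge0; case/andP: (g01 n x).
have part n : (\sum_(0 <= k < n.+1) \sum_(i <oo) (L (H k i))%:E =
    \sum_(i <oo) (L (fun x => F i x * g n x))%:E)%E.
  rewrite -nneseries_sum_nat//; apply: eq_eseriesr => i _.
  rewrite sumEFin big_mkord -(functional_sum (F := H ^~ i))//.
  by congr ((L _)%:E); apply/funext => x; rewrite -sumG mulr_sumr.
have AU : (daniell_outer (A `&` U) <= \sum_(k <oo) \sum_(i <oo) (L (H k i))%:E)%E.
  apply: daniell_outer_le2 => // x [Ax Ux].
  have H0x k i : (0 <= (H k i x)%:E)%E by rewrite lee_fin.
  have [K gK] := gU1 x Ux.
  rewrite (le_trans (FA _ Ax))//.
  apply: (@le_trans _ _ (\sum_(0 <= k < K.+1) \sum_(i <oo) (H k i x)%:E)%E).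
    rewrite -nneseries_sum_nat//; apply: lee_nneseries => [i _ _|i _].
      by rewrite lee_fin (F0 i).2.
    by rewrite sumEFin big_mkord -mulr_sumr sumG gK// mulr1.
  by apply: nneseries_lim_ge => k _ _; apply: nneseries_ge0.
have AUC n : (daniell_outer (A `&` ~` U) <=
    \sum_(i <oo) (L (fun x => F i x * (1 - g n x)))%:E)%E.
  apply: ereal_inf_lbound; exists (fun i x => F i x * (1 - g n x)) => //.
  split=> [i|x [Ax Ux]]; first by split.
  rewrite (le_trans (FA _ Ax))//; apply: lee_nneseries => [i _ _|i _].
    by rewrite lee_fin (F0 i).2.
  by rewrite gU0// subr0 mulr1.
have split n : (\sum_(i <oo) (L (fun x => F i x * g n x))%:E +
    \sum_(i <oo) (L (fun x => F i x * (1 - g n x)))%:E = T)%E.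
  rewrite -nneseriesD; last 2 first.
  - by move=> i _ _; rewrite lee_fin L_ge0// => x; rewrite mulr_ge0 ?(F0 i).2//; case/andP: (g01 n x).
  - by move=> i _ _; rewrite lee_fin L_ge0.
  apply: eq_eseriesr => i _; rewrite -EFinD -LD//.
  by congr ((L _)%:E); apply/funext => x; ring.
(* Finiteness allows this term to be moved to the right, where the inequality is a limit of partial
   sums over k. *)
have finC : daniell_outer (A `&` ~` U) \is a fin_num.
  rewrite ge0_fin_numE ?daniell_outer_ge0// (le_lt_trans (AUC 0%N))//.
  rewrite (@le_lt_trans _ _ T) ?ltey// -(split 0%N) leeDr//.
  apply: nneseries_ge0 => i _ _; rewrite lee_fin L_ge0// => x.
  by rewrite mulr_ge0 ?(F0 i).2//; case/andP: (g01 0%N x).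
rewrite -leeBrDr// (le_trans AU)//; apply: lime_le.
  by apply: is_cvg_nneseries => k _ _; exact: nneseries_ge0.
near=> n.
have n0 : (0 < n)%N by near: n; exact: nbhs_infty_gt.
rewrite -(prednK n0) part leeBrDr// -(split n.-1); apply: leeD2l; exact: AUC.
Unshelve. all: by end_near. Qed.

End daniell.

(** * Dense sequences and cluster points *)

Section total_boundedness.
Context {R : realType} {X : completeMetricType R}.

(** The point [x0] fills the indices that encode no element of the dense set. *)
Lemma separable_enum (x0 : X) : separable_space X ->
  exists z : nat -> X, forall x e, 0 < e -> exists n, mdist x (z n) < e.
Proof.
move=> [D /countable_injP[f injf] dD].
have [z zP] : {z : nat -> X & forall n d, D d -> f d = n -> z n = d}.
  apply: (@choice _ _ (fun n x => forall d, D d -> f d = n -> x = d)) => n.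
  have [[d [Dd fd]]|nd] := pselect (exists d, D d /\ f d = n).
    by exists d => d' Dd' fd'; apply: injf; rewrite ?inE// fd fd'.
  by exists x0 => d Dd fd; exfalso; apply: nd; exists d.
exists z => x e e0.
have [y [xy Dy]] : ball x e `&` D !=set0.
  have [] := dD (ball x e)^°.
  - by exists x; apply: nbhsx_ballx.
  - exact: open_interior.
  - by move=> y [/interior_subset xy Dy]; exists y.
by exists (f y); rewrite (zP _ y)//; move: xy; rewrite ballEmdist.
Qed.

(** An ultrafilter refining the tails contains one ball of each finite net, hence is Cauchy, and
    completeness gives its limit. *)
Lemma totally_bounded_cluster (u : nat -> X) :
  (forall e : R, 0 < e -> exists s : seq X,
     \forall n \near \oo, exists2 z, z \in s & mdist z (u n) < e) ->
  cluster (u @ \oo) !=set0.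
Proof.
move=> tb; have uPF : ProperFilter (u @ \oo) by exact: fmap_proper_filter.
have [G [GU uG]] := ultraFilterLemma uPF.
have Gball (e : R) : 0 < e -> exists z, G (ball z e).
  move=> e0; have [s us] := tb e e0.
  have : G [set y | exists2 z, z \in s & mdist z y < e] by exact: uG.
  elim: s {us} => [|z s ih].
    rewrite (_ : [set _ | _] = set0); first by move/filter_not_empty.
    by apply/seteqP; split => // y [].
  have [Gz _|Gz GA] := in_ultra_setVsetC (ball z e) GU; first by exists z.
  apply: ih; apply: filterS (filterI GA Gz) => y [[t]].
  rewrite inE => /orP[/eqP->|ts]; last by exists t.
  by move=> zy; rewrite ballEmdist.
have cG : cauchy G by apply: cauchy_exP.
have Gp := cauchy_cvg G cG; set p := lim G in Gp.
exists p => A B uA pB; apply: (@filter_ex _ G).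
by apply: filterI; [exact: uG|exact: Gp].
Qed.

End total_boundedness.

(** * Representation of the functional by a probability measure *)

Section daniell_measure.
Context {R : realType} {X : completeMetricType R}.
Hypothesis X_separable : separable_space X.
Variable L : (X -> R) -> R.
Hypothesis LD : forall f g, blip f -> blip g ->
  L (fun x => f x + g x) = L f + L g.
Hypothesis LZ : forall c f, blip f -> L (fun x => c * f x) = c * L f.
Hypothesis L1 : L (cst 1) = 1.
Hypothesis L_ge0 : forall f, blip f -> (forall x, 0 <= f x) -> 0 <= L f.
(** Continuity is assumed along sequences sharing a Lipschitz constant; [functional_tight] extends
    it to sequences whose constants may blow up. *)
Hypothesis L_equilip : forall (f : nat -> X -> R) (M : R),
  (forall k x, 0 <= f k x <= 1) ->
  (forall k x y, `|f k x - f k y| <= M * mdist x y) ->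
  (forall k x, f k.+1 x <= f k x) ->
  (forall x (e : R), 0 < e -> exists k, f k x < e) ->
  forall e : R, 0 < e -> exists k, L (f k) < e.
Implicit Types (f g : X -> R) (A : set X).

(** Pointwise decrease to 0 is uniform on compact sets, as in Dini's theorem. A nearly compact set
    is cut out by distances to finite subsets of a dense sequence, whose Lipschitz constants do not
    depend on the number of points. *)
Lemma functional_tight (h : nat -> X -> R) :
  (forall k, blip (h k)) ->
  (forall k x, 0 <= h k x <= 1) ->
  (forall k x, h k.+1 x <= h k x) ->
  (forall x (e : R), 0 < e -> exists k, h k x < e) ->
  forall e : R, 0 < e -> exists k, L (h k) < e.
Proof.
move=> bh h01 hS h0 e e0.
have hmono x : {homo h ^~ x : i j / (i <= j)%N >-> j <= i}.
  by apply: homo_leq => [//|i j k ij jk|i]; [exact: le_trans jk ij|exact: hS].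
have [z zd] := separable_enum point X_separable.
(* The minimum of 1 and j + 1 times the distance to z_0, ..., z_(k-1). It is (j+1)-Lipschitz for all
   k and tends to 0 by density, so [L_equilip] applies in k. *)
pose f j k (x : X) : R :=
  iteri k (fun i r => Num.min r (Num.min 1 (j.+1%:R * mdist x (z i)))) 1.
have f_rec0 j x : f j 0%N x = 1 by [].
have f_rec j k x : f j k.+1 x = Num.min (f j k x) (Num.min 1 (j.+1%:R * mdist x (z k))).
  by [].
have f01 j k x : 0 <= f j k x <= 1.
  elim: k => [|k /andP[k0 k1]]; first by rewrite f_rec0 ler01 lexx.
  by rewrite f_rec ge_min k1/= !le_min k0 ler01 mulr_ge0// mdist_ge0.
have fS j k x : f j k.+1 x <= f j k x by rewrite f_rec ge_min lexx.
have flip j k x y : f j k x <= f j k y + j.+1%:R * mdist x y.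
  have dj : 0 <= j.+1%:R * mdist x y by rewrite mulr_ge0// mdist_ge0.
  elim: k => [|k ih]; first by rewrite !f_rec0 lerDl.
  rewrite !f_rec -lerBlDr !le_min !lerBlDr !ge_min ih lerDl dj !orbT/=.
  apply/orP; right; apply/orP; right.
  by rewrite -mulrDr ler_pM2l// addrC; exact: metric_triangle.
have flip' j k x y : `|f j k x - f j k y| <= j.+1%:R * mdist x y.
  rewrite ler_norml; apply/andP; split.
    by rewrite lerNl opprB lerBDl metric_sym flip.
  by rewrite lerBDl flip.
have bf j k : blip (f j k).
  exists j.+1%:R => x; split => [|y]; last exact: flip'.
  have /andP[f0 f1] := f01 j k x; rewrite ger0_norm// (le_trans f1)//.
  by rewrite ler1n.
have [k kP] : {k : nat -> nat & forall j, L (f j (k j)) < e / (4 * 2 ^+ j.+1)}.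
  apply: (@choice _ _ (fun j k => L (f j k) < e / (4 * 2 ^+ j.+1))) => j.
  apply: (@L_equilip _ j.+1%:R) => //.
  - move=> x d d0; have [n xn] := zd x (d / j.+1%:R) (divr_gt0 d0 (ltr0Sn _ _)).
    exists n.+1; rewrite f_rec !gt_min; apply/orP; right; apply/orP; right.
    by rewrite mulrC -ltr_pdivlMr.
  - by rewrite divr_gt0// mulr_gt0// exprn_gt0.
(* Otherwise each J has a witness u_J violating the bound; as h <= 1, all f j (k j) with j < J are
   below 1/2 at u_J. So the tails of u lie near finite nets at every scale, and u has a cluster
   point p. *)
have [J JP] : exists J, forall x, h J x <= e / 4 + 2 * \sum_(j < J) f j (k j) x.
  apply: contrapT => /forallNP nJ.
  have [u uP] : {u : nat -> X & forall J,
      e / 4 + 2 * \sum_(j < J) f j (k j) (u J) < h J (u J)}.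
    apply: (@choice _ _ (fun J x =>
      e / 4 + 2 * \sum_(j < J) f j (k j) x < h J x)) => J.
    have /existsNP[x /negP] := nJ J; rewrite -ltNge => xJ; by exists x.
  have sum0 J x : 0 <= \sum_(j < J) f j (k j) x.
    by apply: sumr_ge0 => j _; case/andP: (f01 j (k j) x).
  have fu J j : (j < J)%N -> f j (k j) (u J) < 2^-1.
    move=> jJ; have := uP J; rewrite (bigD1 (Ordinal jJ))//=.
    set s := \sum_(i < J | _) _.
    have s0 : 0 <= s by apply: sumr_ge0 => i _; case/andP: (f01 i (k i) (u J)).
    by have /andP[_ h1] := h01 J (u J); lra.
  have [p pu] : cluster (u @ \oo) !=set0.
    apply: totally_bounded_cluster => d d0.
    pose j := Num.truncn d^-1.
    have jd : d^-1 < j.+1%:R by rewrite truncnS_gt.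
    exists [seq z i | i <- iota 0 (k j)]; near=> J.
    have jJ : (j < J)%N by near: J; exact: nbhs_infty_gt.
    have : f j (k j) (u J) < 2^-1 by exact: fu.
    elim: (k j) => [|m ih].
      by rewrite f_rec0 => ?; exfalso; lra.
    rewrite f_rec gt_min => /orP[/ih[y]|].
      move=> /mapP[i]; rewrite mem_iota add0n => /andP[_ im] -> yu.
      exists (z i) => //; apply/mapP; exists i => //.
      by rewrite mem_iota add0n/= (ltn_trans im).
    rewrite gt_min => /orP[|zu]; first by move=> ?; exfalso; lra.
    exists (z m); first by apply/mapP; exists m => //; rewrite mem_iota add0n/=.
    rewrite metric_sym -(@ltr_pM2l _ j.+1%:R)// (lt_trans zu)//.
    rewrite (@lt_trans _ _ 1)//; first by lra.
    by rewrite -ltr_pdivrMr// div1r.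
  (* Some h m is below e / 4 near p, whereas h m (u_J) >= h J (u_J) > e / 4 for J >= m. *)
  have [m hm] := h0 p (e / 4) ltac:(lra).
  have hU : nbhs p [set x | h m x < e / 4].
    exact: (cvgr_lt (h m p) (blip_continuous (bh m) (x := p))).
  have uU : (u @ \oo) [set x | e / 4 < h m x].
    exists m => //= J mJ; apply: lt_le_trans (hmono (u J) _ _ mJ).
    by rewrite (le_lt_trans _ (uP J))// lerDl mulr_ge0.
  by have [y [/= y1 y2]] := pu _ _ uU hU; lra.
exists J.
have bS : blip (fun x => \sum_(j < J) f j (k j) x).
  by apply: (@blip_sum _ _ (fun j => f j (k j))).
rewrite (@le_lt_trans _ _ (L (fun x => e / 4 * cst 1 x + 2 * \sum_(j < J) f j (k j) x)))//.
  apply: le_functional => //; last by move=> x; rewrite mulr1.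
  apply: blipD; apply: blipM => //; exact: blip_cst.
rewrite LD; last 2 first.
- by apply: blipM; exact: blip_cst.
- by apply: blipM => //; exact: blip_cst.
rewrite !LZ//; last exact: blip_cst.
rewrite L1 (@functional_sum _ _ L LD LZ (fun j => f j (k j)))//.
have : \sum_(j < J) L (f j (k j)) <= e / 4.
  rewrite (@le_trans _ _ (\sum_(j < J) e / (4 * 2 ^+ j.+1)))//.
    by apply: ler_sum => j _; exact/ltW.
  rewrite (_ : \sum_(_ < _) _ = e / 4 * (1 - (2 ^+ J)^-1)); last first.
    elim: J {JP bS} => [|J ih]; first by rewrite big_ord0 expr0 invr1 subrr mulr0.
    rewrite big_ord_recr/= ih exprS.
    have : (2 ^+ J : R) != 0 by rewrite expf_neq0.
    by move: (2 ^+ J) => t t0; field.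
  by rewrite ler_piMr// ?divr_ge0 ?(ltW e0)// gerBl invr_ge0 exprn_ge0.
lra.
Unshelve. all: by end_near. Qed.

Let outer : {outer_measure set X -> \bar R} := daniell_outer_measure LZ L_ge0.

Let outer_le A h : blip h -> (forall x, 0 <= h x) -> (forall x, A x -> 1 <= h x) ->
  (daniell_outer L A <= (L h)%:E)%E.
Proof.
move=> bh h0 hA; pose F i : X -> R := if i is 0%N then h else cst 0.
have sumF (G : (X -> R) -> R) : 0 <= G h -> G (cst 0) = 0 ->
    (\sum_(i <oo) (G (F i))%:E = (G h)%:E)%E.
  move=> Gh G0; rewrite (@nneseriesD1 _ _ 0%N xpredT)//=; last first.
    by move=> [|i] _ /=; rewrite ?G0 lee_fin.
  rewrite eseries0 ?adde0// => -[|i]//= _ _.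
  by rewrite G0.
apply: ereal_inf_lbound; exists F; last first.
  by rewrite (sumF L) ?L_ge0// (functional0 LZ).
split=> [[|i] /=|x Ax]; [by []|by split => //; exact: blip_cst|].
by rewrite (sumF (fun f => f x))// lee_fin hA.
Qed.

(** Tightness enters in the lower bound: the uncovered parts max(0, 1 - sum_(i<n) F_i) decrease to
    0, so L of them becomes small and no cover costs less than 1. *)
Let outer_setT : daniell_outer L [set: X] = 1%E.
Proof.
apply/eqP; rewrite eq_le; apply/andP; split.
  rewrite -L1; apply: outer_le => //; exact: blip_cst.
apply: le_ereal_inf_tmp => _ [F [F0 FT] <-].
apply/lee_addgt0Pr => e e0.
pose h n x : R := Num.max 0 (1 - \sum_(i < n) F i x).
have bS n : blip (fun x => \sum_(i < n) F i x).
  by apply: blip_sum => i; exact: (F0 i).1.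
have sum0 n x : 0 <= \sum_(i < n) F i x.
  by apply: sumr_ge0 => i _; exact: (F0 i).2.
have [n hn] : exists n, L (h n) < e.
  apply: functional_tight => //.
  - by move=> n; apply: blip_max; [|apply: blipB]=> //; exact: blip_cst.
  - by move=> n x; rewrite le_max lexx/= ge_max ler01 gerBl sum0.
  - move=> n x; rewrite /h ge_max !le_max lexx/= big_ord_recr/= opprD addrA.
    by rewrite gerBl (F0 n).2 orbT.
  - move=> x d d0.
    have F0x i : (0 <= i)%N -> true -> (0 <= (F i x)%:E)%E.
      by move=> _ _; rewrite lee_fin (F0 i).2.
    have FTx := FT x Logic.I.
    apply: contrapT => /forallNP nh.
    have : (\sum_(i <oo) (F i x)%:E <= (1 - d)%:E)%E.
      apply: lime_le; first exact: is_cvg_nneseries.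
      near=> n; rewrite sumEFin lee_fin big_mkord.
      have /negP := nh n; rewrite -leNgt /h le_max leNgt d0/= lerBrDr addrC -lerBrDr.
      by [].
    by move=> /(le_trans FTx); rewrite lee_fin; lra.
apply: (@le_trans _ _ (\sum_(0 <= i < n) (L (F i))%:E + e%:E)%E); last first.
  apply: leeD2r; apply: nneseries_lim_ge => i _ _.
  by rewrite lee_fin; have [] := F0 i; exact: L_ge0.
rewrite sumEFin -EFinD lee_fin big_mkord -(functional_sum LD LZ)//; last first.
  by move=> i; exact: (F0 i).1.
rewrite -lerBlDl -L1 -(functionalB LD LZ)//; last exact: blip_cst.
rewrite (le_trans _ (ltW hn))//; apply: (le_functional LD LZ) => //.
- by apply: blipB => //; exact: blip_cst.
- by apply: blip_max; [|apply: blipB]=> //; exact: blip_cst.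
- by move=> x; rewrite le_max lexx orbT.
Unshelve. all: by end_near. Qed.

Let borel_caratheodory (A : set (borel X)) : measurable A ->
  caratheodory_measurable outer A.
Proof.
move: A; apply: smallest_sub.
  split; first exact: caratheodory_measurable_set0.
  - by move=> A cA; rewrite setTD; exact: caratheodory_measurable_setC.
  - by move=> F cF; exact: caratheodory_measurable_bigcup.
by move=> U oU; exact: open_daniell_caratheodory.
Qed.

Let outer_probability : exists mu : probability (borel X) R,
  forall A : set X, mu A = daniell_outer L A.
Proof.
pose m0 : set (borel X) -> \bar R := daniell_outer L.
have m_sigma : semi_sigma_additive m0.
  move=> F mF tF mUF; apply: (@caratheodory_measure_sigma_additive R X outer) => //.
  - by move=> i; apply: borel_caratheodory; exact: mF.
  - exact: borel_caratheodory.
pose M := isMeasure.Build _ (borel X) R m0 (outer_measure0 outer)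
  (outer_measure_ge0 outer) m_sigma.
pose m : {measure set (borel X) -> \bar R} :=
  HB.pack_for {measure set (borel X) -> \bar R} m0 M.
pose PM := Measure_isProbability.Build _ _ _ m outer_setT.
by exists (HB.pack_for (probability (borel X) R) m0 M PM).
Qed.

(** The outer measure yields only upper bounds, hence integral <= L for 0 <= f <= 1. Applied to 1 -
    f this gives equality, and an affine change of f covers the rest. *)
Lemma daniell_representation : exists mu : probability (borel X) R,
  forall f, blip f -> \int[mu]_x f x = L f.
Proof.
have [mu muE] := outer_probability; exists mu.
have le1 f : blip f -> (forall x, 0 <= f x <= 1) -> \int[mu]_x f x <= L f.
  move=> bf f01; apply/ler_addgt0Pr => e e0.
  pose N := (Num.truncn e^-1).+1.
  have Ne : N%:R^-1 < e by rewrite invf_plt ?posrE// truncnS_gt.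
  pose t j : R := j%:R / N%:R.
  have tS j : t j.+1 = t j + N%:R^-1 by rewrite /t -natr1 mulrDl mul1r.
  (* Horizontal layers of f of height 1/N. Since N s_j >= 1 where f >= t_(j+1), they bound the outer
     measure of that set, while s_j <= 1/N on {f >= t_j} and 0 elsewhere. *)
  pose s j x := Num.min (f x) (t j.+1) - Num.min (f x) (t j).
  have bs j : blip (s j) by apply: blipB; apply: blip_min => //; exact: blip_cst.
  have N0 : 0 < N%:R^-1 :> R by rewrite invr_gt0.
  have s0 j x : 0 <= s j x.
    by rewrite /s subr_ge0 le_min !ge_min lexx/= tS lerDl (ltW N0) orbT.
  have s_le j x : s j x <= N%:R^-1 * \1_[set x | t j <= f x] x.
    rewrite indicE /s tS; have [fx|fx] := leP (t j) (f x).
      rewrite mem_set//= mulr1.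
      by rewrite lerBlDl ge_min lexx orbT.
    rewrite memNset/=; last by apply/negP; rewrite -ltNge.
    by rewrite mulr0 min_l ?subrr// (le_trans (ltW fx))// lerDl ltW.
  have sum_s x : \sum_(j < N) s j x = f x.
    rewrite -(big_mkord xpredT (s ^~ x)) telescope_sumr// /t mul0r divff ?pnatr_eq0//.
    by have /andP[f0 f1] := f01 x; rewrite min_l// min_r// subr0.
  pose A j := [set x | t j <= f x].
  have mA j : measurable (A j : set (borel X)).
    rewrite (_ : A j = ~` [set x | f x < t j]); last first.
      by rewrite /A; apply/seteqP; split=> x /=; rewrite leNgt => /negP.
    apply: measurableC; apply: open_borel_measurable.
    apply: (@open_comp _ _ f [set y | y < t j]); last exact: open_lt.
    by move=> x _; exact: blip_continuous.
  have muA j : fine (mu (A j.+1)) <= N%:R * L (s j).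
    rewrite -lee_fin fineK ?fin_num_measure// muE -LZ//; apply: outer_le.
    - by apply: blipM => //; exact: blip_cst.
    - by move=> x; rewrite mulr_ge0.
    - move=> x Ax; rewrite /s min_r// min_r; last first.
        by rewrite (le_trans _ Ax)// tS lerDl ltW.
      by rewrite tS addrAC subrr add0r divff ?pnatr_eq0.
  (* Passing from level t_j to t_(j+1) costs one extra layer of height 1/N < e. *)
  have f_le x : f x <= N%:R^-1 * (1 + \sum_(j < N) \1_(A j.+1) x).
    rewrite -sum_s (@le_trans _ _ (\sum_(j < N) N%:R^-1 * \1_(A j) x))//.
      by apply: ler_sum => j _; exact: s_le.
    rewrite -mulr_sumr ler_wpM2l ?(ltW N0)//.
    rewrite /N [leLHS]big_ord_recl [X in _ <= 1 + X]big_ord_recr/= lerD//.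
    by rewrite lerDl indicE ler0n.
  have bA n : bmeas (fun x : borel X => \sum_(j < n) \1_(A j.+1) x : R).
    by apply: (@bmeas_sum _ (borel X) R n (fun j => \1_(A j.+1))) => j; exact: bmeas_indic.
  apply: (@le_trans _ _ (\int[mu]_x (N%:R^-1 * (1 + \sum_(j < N) \1_(A j.+1) x)))).
    apply: le_Rintegral_bmeas => //; first exact: blip_bmeas.
    by apply: bmeasM; [exact: bmeas_cst|apply: bmeasD; [exact: bmeas_cst|exact: bA]].
  rewrite RintegralZl_bmeas; last by apply: bmeasD; [exact: bmeas_cst|exact: bA].
  rewrite RintegralD_bmeas; [|exact: bmeas_cst|exact: bA].
  rewrite Rintegral_probability_cst.
  rewrite (@Rintegral_sum_bmeas _ (borel X) R mu N (fun j => \1_(A j.+1))); last first.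
    by move=> j; exact: bmeas_indic.
  under eq_bigr do rewrite Rintegral_indic//.
  rewrite mulrDr mulr1 addrC; apply: lerD; last exact: ltW.
  rewrite ler_pdivrMl//.
  have -> : f = (fun x => \sum_(j < N) s j x) by apply/funext => x; rewrite sum_s.
  rewrite (functional_sum LD LZ)// mulr_sumr; apply: ler_sum => j _; exact: muA.
have eq1 f : blip f -> (forall x, 0 <= f x <= 1) -> \int[mu]_x f x = L f.
  move=> bf f01; apply/eqP; rewrite eq_le le1//=.
  have bf' : blip (fun x => 1 - f x) by apply: blipB => //; exact: blip_cst.
  have := le1 _ bf'; rewrite (functionalB LD LZ (blip_cst 1) bf) L1.
  rewrite RintegralB//; last 2 first.
    by apply: bmeas_integrable; exact: bmeas_cst.
    by apply: bmeas_integrable; exact: blip_bmeas.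
  rewrite Rintegral_probability_cst lerD2l lerN2; apply=> x.
  by have /andP[f0 f1] := f01 x; rewrite subr_ge0 f1 gerBl.
move=> f bf; have [M fM] := blip_bounded bf.
have [K K0 fK] : exists2 K, 0 < K & forall x, - K <= f x <= K.
  exists (`|M| + 1) => [|x]; first by rewrite ltr_wpDl.
  by rewrite -ler_norml (le_trans (fM x))// (le_trans (ler_norm M))// lerDl.
pose g x := (2 * K)^-1 * (f x + K).
have bg : blip g by apply: blipM; [|apply: blipD => //]; exact: blip_cst.
have g01 x : 0 <= g x <= 1.
  have /andP[f1 f2] := fK x; rewrite /g mulrC ler_pdivrMr ?mulr_gt0//.
  by apply/andP; split; [apply: divr_ge0; lra|lra].
have fE : f = (fun x => 2 * K * g x - K).
  apply/funext => x; rewrite /g mulrA divff ?mul1r ?addrK//.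
  by rewrite mulf_neq0// gt_eqF.
have b2 : blip (fun x => 2 * K * g x) by apply: blipM => //; exact: blip_cst.
rewrite fE (functionalB LD LZ b2 (blip_cst K)) LZ// -eq1//.
rewrite RintegralB//; last 2 first.
- by apply: bmeas_integrable; exact: blip_bmeas.
- by apply: bmeas_integrable; exact: bmeas_cst.
rewrite RintegralZl_bmeas; last exact: blip_bmeas.
rewrite Rintegral_probability_cst; congr (_ - _).
rewrite -[LHS]mulr1 -L1 -LZ; last exact: blip_cst.
by congr L; apply/funext => x; rewrite mulr1.
Qed.

End daniell_measure.

(** * Integrals against set functions *)

Section set_function_integral.
Context {d : measure_display} {T : measurableType d} {R : realType}.
Import HBNNSimple.

(* The integral is defined for arbitrary set functions, and iterates of
   [P_dual] are only known to be measures on the measurable sets. *)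
Lemma integral_congr_measurable (m1 m2 : set T -> \bar R) (f : T -> \bar R) :
  (forall A, measurable A -> m1 A = m2 A) ->
  (\int[m1]_x f x = \int[m2]_x f x)%E.
Proof.
move=> m12; rewrite /integral.
have E (g : T -> \bar R) :
  ereal_sup [set sintegral m1 h | h in [set h : {nnsfun T >-> R} |
    forall x, ((h x)%:E <= g x)%E]] =
  ereal_sup [set sintegral m2 h | h in [set h : {nnsfun T >-> R} |
    forall x, ((h x)%:E <= g x)%E]].
  congr ereal_sup; apply/seteqP; split=> _ [h hg <-]; exists h => //;
    rewrite /sintegral; apply: eq_fsbigr => r _; by rewrite m12.
by rewrite !E.
Qed.

End set_function_integral.

Lemma subprobability_probability {d : measure_display} {T : measurableType d}
  {R : realType} (m : subprobability T R) : m setT = 1%E ->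
  exists m' : probability T R, (m' : set T -> \bar R) = m.
Proof.
move=> mT.
pose PM := isProbability.Build _ _ _ (SubProbability.sort m) mT.
by exists (HB.pack_for (probability T R) (SubProbability.sort m) PM
  (SubProbability.class m)).
Qed.

(** * The operator, its dual and their iterates *)

Section dual.
Context {R : realType} {X : completeMetricType R}.
Context {d : measure_display} {Theta : measurableType d}.
Variables (vartheta : X -> probability Theta R) (S : Theta -> X -> X).
Hypothesis S_measurable : measurable_fun [set: Theta * borel X]
    ((fun p => S p.1 p.2) : Theta * borel X -> borel X).
Hypothesis vartheta_measurable : forall A : set Theta, measurable A ->
  measurable_fun [set: borel X] ((fun x => vartheta x A) : borel X -> \bar R).
Local Notation P := (P_op vartheta S).

Lemma S_measurable1 (x : X) :
  measurable_fun [set: Theta] ((fun t => S t x) : Theta -> borel X).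
Proof.
apply: (measurableT_comp S_measurable (g := fun t => (t, x : borel X))).
exact: pair2_measurable.
Qed.

Lemma bmeas_comp_S (f : X -> R) x : bmeas (f : borel X -> R) ->
  bmeas (fun t => f (S t x)).
Proof.
move=> [mf [M fM]]; split; last by exists M.
by apply: (measurableT_comp (f := f : borel X -> R)) => //; exact: S_measurable1.
Qed.

(** The transition kernel: the law of S_theta(x). The dual operator is the monadic bind with it. *)
Let step (x : borel X) : giry (borel X) R :=
  giry_map (S_measurable1 x) (vartheta x).

(** Both the measure and the event depend on x. The event is the section at x of a product
    measurable set, so section measurability for the kernel vartheta applies. *)
Let measurable_step : measurable_fun [set: borel X] step.
Proof.
apply: measurable_giry_codensity => // A mA.
pose k0 (x : borel X) : {measure set Theta -> \bar R} := vartheta x.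
pose K := isKernel.Build _ _ (borel X) Theta R k0 vartheta_measurable.
pose k1 : R.-ker (borel X) ~> Theta := HB.pack_for (R.-ker (borel X) ~> Theta) k0 K.
have k1T x : k1 x setT = 1%E := probability_setT (vartheta x).
pose K1 := Kernel_isProbability.Build _ _ (borel X) Theta R k1 k1T.
pose k : R.-pker (borel X) ~> Theta := HB.pack_for (R.-pker (borel X) ~> Theta) k0 K K1.
pose A' : set (borel X * Theta) := [set p | A (S p.2 p.1)].
have mA' : measurable A'.
  rewrite -[A']setTI.
  have mS2 : measurable_fun [set: borel X * Theta]
      ((fun p => S p.2 p.1) : borel X * Theta -> borel X).
    have := measurableT_comp S_measurable (@measurable_swap _ _ (borel X) Theta).
    by apply: eq_measurable_fun => -[].
  exact: mS2.
have := @measurable_fun_xsection_finite_kernel _ _ _ _ R k A' (mem_set mA').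
apply: eq_measurable_fun => x _.
rewrite /step /=; congr (vartheta x _); apply/seteqP.
by split => t; rewrite /xsection/= inE.
Qed.

Let step_int x (f : borel X -> R) : measurable_fun [set: borel X] f ->
  (forall y, 0 <= f y) ->
  giry_int (step x) (EFin \o f) = (\int[vartheta x]_t (f (S t x))%:E)%E.
Proof. by move=> mf f0; rewrite giry_int_map//; exact/measurable_EFinP. Qed.

Lemma P_op_bmeas (f : X -> R) : bmeas (f : borel X -> R) ->
  bmeas (P f : borel X -> R).
Proof.
have pos (g : X -> R) : bmeas (g : borel X -> R) -> (forall y, 0 <= g y) ->
    measurable_fun [set: borel X] (P g : borel X -> R).
  move=> [mg _] g0.
  rewrite (_ : P g = fun x => fine (giry_int (step x) (EFin \o g))); last first.
    by apply/funext => x; rewrite step_int.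
  have mG : measurable_fun [set: giry (borel X) R]
      (fun m : giry (borel X) R => giry_int m (EFin \o g)).
    by apply: measurable_giry_int => [|x]; [exact/measurable_EFinP|rewrite lee_fin].
  apply: (measurableT_comp (f := @fine R)) => //.
  exact: (measurableT_comp mG measurable_step).
move=> bf; have [mf [M fM]] := bf; split.
  (* A shift by the bound reduces to nonnegative functions, for which the Giry integral is
     evaluated. *)
  pose g x := f x + M.
  have bg : bmeas (g : borel X -> R) by apply: bmeasD => //; exact: bmeas_cst.
  have g0 y : 0 <= g y by rewrite -lerBlDr sub0r; have := fM y; rewrite ler_norml => /andP[].
  rewrite (_ : P f = fun x => P g x - M); last first.
    apply/funext => x; rewrite /P_op/g RintegralD_bmeas.
    - by rewrite Rintegral_probability_cst addrK.
    - exact: bmeas_comp_S.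
    - exact: bmeas_cst.
  by apply: measurable_funB => //; exact: pos.
exists M => x; rewrite ler_norml; apply/andP; split.
  rewrite -[leLHS](Rintegral_probability_cst (vartheta x)).
  apply: le_Rintegral_bmeas; [exact: bmeas_cst|exact: bmeas_comp_S|].
  by move=> t; have := fM (S t x); rewrite ler_norml => /andP[].
rewrite -[leRHS](Rintegral_probability_cst (vartheta x)).
apply: le_Rintegral_bmeas; [exact: bmeas_comp_S|exact: bmeas_cst|].
by move=> t; have := fM (S t x); rewrite ler_norml => /andP[].
Qed.

Lemma P_dual_probability (mu : probability (borel X) R) :
  exists m : probability (borel X) R,
  (forall A, measurable A -> m A = P_dual vartheta S mu A) /\
  forall f : X -> R, bmeas (f : borel X -> R) -> \int[m]_x f x = \int[mu]_x P f x.
Proof.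
pose m0 : giry (borel X) R := giry_bind mu measurable_step.
have m0E A : measurable A -> m0 A = P_dual vartheta S mu A.
  move=> mA.
  have : giry_int m0 (EFin \o \1_A) = P_dual vartheta S mu A.
    rewrite giry_int_bind//.
    - apply: eq_integral => x _; rewrite step_int//.
    - by apply/measurable_EFinP; exact: measurable_indic.
    - by move=> x; rewrite lee_fin.
  by move=> <-; rewrite /giry_int integral_indic// setIT.
have m0T : m0 setT = 1%E.
  rewrite m0E// /P_dual (eq_integral (cst 1%E)).
    by rewrite integral_cst// mul1e; exact: (probability_setT mu).
  move=> x _; rewrite (eq_integral (cst 1%E)).
    by rewrite integral_cst// mul1e; exact: (probability_setT (vartheta x)).
  by move=> t _; rewrite indicT.
have [m mE] := subprobability_probability m0T.
exists m; split=> [A mA|]; first by rewrite -m0E// mE.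
have pos (g : X -> R) : bmeas (g : borel X -> R) -> (forall y, 0 <= g y) ->
    \int[m]_x g x = \int[mu]_x P g x.
  move=> bg g0; have [mg _] := bg.
  transitivity (fine (giry_int m0 (EFin \o g))).
    congr fine; apply: integral_congr_measurable => A _.
    exact: (congr1 (@^~ A) mE).
  rewrite /m0 giry_int_bind; [|exact/measurable_EFinP|by move=> x; rewrite lee_fin].
  congr fine; apply: eq_integral => x _; rewrite step_int// -Rintegral_EFin//.
  exact: bmeas_comp_S.
move=> f bf; have [mf [M fM]] := bf.
pose g x := f x + M.
have bg : bmeas (g : borel X -> R) by apply: bmeasD => //; exact: bmeas_cst.
have g0 y : 0 <= g y by rewrite -lerBlDr sub0r; have := fM y; rewrite ler_norml => /andP[].
have := pos g bg g0; rewrite RintegralD_bmeas//; last exact: bmeas_cst.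
rewrite (_ : P g = fun x => P f x + M); last first.
  apply/funext => x; rewrite /P_op/g RintegralD_bmeas.
  - by rewrite Rintegral_probability_cst.
  - exact: bmeas_comp_S.
  - exact: bmeas_cst.
rewrite RintegralD_bmeas; [|exact: P_op_bmeas|exact: bmeas_cst].
by rewrite !Rintegral_probability_cst; move/addIr.
Qed.

Lemma iter_P_op_bmeas (f : X -> R) n : bmeas (f : borel X -> R) ->
  bmeas (iter n P f : borel X -> R).
Proof. by move=> bf; elim: n => //= n ih; exact: P_op_bmeas. Qed.

Lemma iter_P_dual_probability (mu : probability (borel X) R) n :
  exists m : probability (borel X) R,
  (forall A, measurable A -> m A = iter n (P_dual vartheta S) mu A) /\
  forall f : X -> R, bmeas (f : borel X -> R) ->
    \int[m]_x f x = \int[mu]_x iter n P f x.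
Proof.
elim: n => [|n [m [mE mP]]]; first by exists mu.
have [m' [mE' mP']] := P_dual_probability m; exists m'; split.
  by move=> A mA; rewrite mE'//=; exact: integral_congr_measurable.
move=> f bf; rewrite mP'// mP; last exact: P_op_bmeas.
by rewrite iterSr.
Qed.

End dual.

(** * Bounded convergence *)

Section bounded_convergence.
Context {d : measure_display} {T : measurableType d} {R : realType}.

Lemma bounded_cvg_Rintegral (mu : probability T R) (g : nat -> T -> R)
    (f : T -> R) (M : R) :
  (forall n, measurable_fun [set: T] (g n)) ->
  (forall n x, `|g n x| <= M) ->
  (forall x, g n x @[n --> \oo] --> f x) ->
  bmeas f /\ \int[mu]_x g n x @[n --> \oo] --> \int[mu]_x f x.
Proof.
move=> mg gM gf.
have mf : measurable_fun [set: T] f.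
  by apply: (measurable_fun_cvg mg) => x _; exact: gf.
have fM x : `|f x| <= M.
  have ng : `|g n x| @[n --> \oo] --> `|f x| by apply: cvg_norm; exact: gf.
  rewrite -(cvg_lim _ ng)//.
  by apply: limr_le; [exact: cvgP ng|exact: nearW].
have bf : bmeas f by split => //; exists M.
split=> //.
have [_ _] := @dominated_convergence _ T R mu setT measurableT
  (fun n x => (g n x)%:E) (fun x => (f x)%:E) (cst M%:E)
  ltac:(by move=> n; exact/measurable_EFinP)
  ltac:(exact/measurable_EFinP)
  ltac:(by apply: aeW => x _; apply: cvg_EFin; [exact: nearW|exact: gf])
  ltac:(by apply: bmeas_integrable; exact: bmeas_cst)
  ltac:(by apply: aeW => x n _; rewrite lee_fin).
rewrite Rintegral_EFin//; exact: fine_cvg.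
Qed.

End bounded_convergence.

(** * Weak convergence tested on bounded Lipschitz functions *)

Section weak_convergence.
Context {R : realType} {X : completeMetricType R}.
Implicit Types (f : X -> R).

Lemma Cb_bound f : Cb f -> exists2 M : R, 0 <= M & forall x, `|f x| <= M.
Proof.
move=> [_ [N [_ fN]]]; exists (`|N| + 1); first by rewrite addr_ge0.
by move=> x; apply: fN => //; rewrite ltr_pwDr// ler_norm.
Qed.

Lemma Cb_bmeas f : Cb f -> bmeas (f : borel X -> R).
Proof.
move=> cf; split; last by have [M _ fM] := Cb_bound cf; exists M.
by case: cf => cf _; exact: continuous_borel_measurable.
Qed.

(** The infimal convolution inf_y (f(y) + k d(x, y)), the largest k-Lipschitz minorant of f. *)
Lemma Cb_blip_approx f : Cb f -> exists (g : nat -> X -> R) (M : R),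
  [/\ forall k, blip (g k), forall k x, g k x <= f x,
      forall k x, `|g k x| <= M & forall x, g k x @[k --> \oo] --> f x].
Proof.
move=> Cf; have [M M0 fM] := Cb_bound Cf; have [cf _] := Cf.
have fM' x : - M <= f x <= M by rewrite -ler_norml.
pose D k x := [set f y + k%:R * mdist x y | y in [set: X]].
have kd (k : nat) (x y : X) : 0 <= k%:R * mdist x y by rewrite mulr_ge0// mdist_ge0.
have lbD k x : lbound (D k x) (- M).
  by move=> _ [y _ <-]; have := kd k x y; have /andP[] := fM' y; lra.
have iD k x : has_inf (D k x).
  by split; [exists (f x + k%:R * mdist x x); exists x|exists (- M)].
pose g k x := inf (D k x).
have gf k x : g k x <= f x.
  apply: ge_inf; first by exists (- M).
  by exists x => //; rewrite mdistxx mulr0 addr0.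
have gM k x : - M <= g k x by apply: lb_le_inf => //; exact: (iD k x).1.
have gl k x y : g k x - g k y <= k%:R * mdist x y.
  rewrite lerBlDr -lerBlDl; apply: lb_le_inf; first exact: (iD k y).1.
  move=> _ [z _ <-]; rewrite lerBlDl (@le_trans _ _ (f z + k%:R * mdist x z))//.
    by apply: ge_inf; [exists (- M)|exists z].
  by rewrite addrCA lerD2l -mulrDr ler_wpM2l// metric_triangle.
have gM' k x : `|g k x| <= M.
  by rewrite ler_norml gM (le_trans (gf k x))//; case/andP: (fM' x).
exists g, M; split => // [k|x].
  exists (M + k%:R) => x; split=> [|y].
    by rewrite (le_trans (gM' k x))// lerDl.
  have := mulr_ge0 M0 (mdist_ge0 x y).
  rewrite mulrDl ler_norml; have := gl k x y; have := gl k y x.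
  by rewrite [mdist y x]metric_sym => *; apply/andP; split; lra.
apply/cvgrPdist_le => /= e e0.
have /cvgrPdist_le/(_ e e0)/nbhs_ballP[r /= r0 fr] := cf x.
near=> k.
rewrite ger0_norm ?subr_ge0// lerBlDr -lerBlDl.
apply: lb_le_inf; first exact: (iD k x).1.
move=> _ [y _ <-]; have [xy|xy] := ltP (mdist x y) r.
  have := fr y; rewrite ballEmdist /= => /(_ xy); rewrite ler_norml => /andP[_].
  by have := kd k x y; lra.
(* Beyond distance r the penalty is then at least 2M, so such y cannot push the infimum below
   f(x). *)
have kr : 2 * M / r <= k%:R by near: k; exact: nbhs_infty_ger.
rewrite ler_pdivrMr// in kr.
have krd : k%:R * r <= k%:R * mdist x y by rewrite ler_wpM2l.
by have := fM' x; have := fM' y; lra.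
Unshelve. all: by end_near. Qed.

(** Lipschitz minorants control the lower limit; the upper limit is the same statement for -f. *)
Lemma blip_cvg_Cb (m : nat -> probability (borel X) R)
    (mu : probability (borel X) R) :
  (forall f, blip f -> \int[m n]_x f x @[n --> \oo] --> \int[mu]_x f x) ->
  forall f, Cb f -> \int[m n]_x f x @[n --> \oo] --> \int[mu]_x f x.
Proof.
move=> mcvg.
have below f e : Cb f -> 0 < e ->
    \forall n \near \oo, \int[mu]_x f x - e <= \int[m n]_x f x.
  move=> Cf e0; have [g [M [bg gf gM gcvg]]] := Cb_blip_approx Cf.
  have [_ gint] := @bounded_cvg_Rintegral _ (borel X) R mu g f M
    (fun k => (blip_bmeas (bg k)).1) gM gcvg.
  have e2 : 0 < e / 2 by rewrite divr_gt0.
  have /cvgrPdist_le/(_ _ e2)[k _ kP] := gint.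
  have := kP k (leqnn k); rewrite /= ler_norml => /andP[_ gk].
  have /cvgrPdist_le/(_ _ e2) := mcvg _ (bg k); apply: filterS => n.
  rewrite ler_norml => /andP[_ mk].
  have : \int[m n]_x g k x <= \int[m n]_x f x.
    by apply: le_Rintegral_bmeas => //; [exact: blip_bmeas|exact: Cb_bmeas].
  by lra.
move=> f Cf; apply/cvgrPdist_le => /= e e0.
have Cf' : Cb (fun x => - f x).
  case: (Cf) => cf bf; split; first by move=> x; apply: cvgN; exact: cf.
  have [M M0 fM] := Cb_bound Cf.
  by exists M; split; [exact: num_real|move=> N MN x _ /=; rewrite normrN (le_trans (fM x))// ltW].
have RN (p : probability (borel X) R) : \int[p]_x (- f x) = - \int[p]_x f x.
  rewrite -[RHS]mulN1r -RintegralZl_bmeas; last exact: Cb_bmeas.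
  by apply: eq_Rintegral => x _; rewrite mulN1r.
have := below _ _ Cf' e0; have := below _ _ Cf e0.
apply: filterS2 => n; rewrite !RN => h1 h2; rewrite ler_norml.
by apply/andP; split; lra.
Qed.

(** Lipschitz functions increasing to indicators give equality on open sets, a generating class
    stable under intersection. *)
Lemma eq_probability_blip (mu1 mu2 : probability (borel X) R) :
  (forall f, blip f -> \int[mu1]_x f x = \int[mu2]_x f x) ->
  forall A : set (borel X), measurable A -> mu1 A = mu2 A.
Proof.
move=> E.
have openE (U : set X) : open U -> mu1 U = mu2 U.
  move=> oU; have [g [bg g01 _ gU0 gU1]] := open_blip_approx oU.
  have mU : measurable (U : set (borel X)) by exact: open_borel_measurable.
  have gM k x : `|g k x| <= 1.
    by have /andP[g0 g1] := g01 k x; rewrite ger0_norm.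
  have gcvg x : g k x @[k --> \oo] --> (\1_U x : R).
    apply: cvg_near_cst; rewrite indicE; have [Ux|Ux] := pselect (U x).
      have [K KP] := gU1 x Ux; exists K => // k /= Kk.
      by rewrite KP// mem_set.
    by apply: nearW => k; rewrite memNset// gU0.
  have H (p : probability (borel X) R) :
      \int[p]_x g k x @[k --> \oo] --> fine (p U).
    have [_] := @bounded_cvg_Rintegral _ (borel X) R p g (\1_U) 1
      (fun k => (blip_bmeas (bg k)).1) gM gcvg.
    by rewrite Rintegral_indic.
  rewrite -[LHS]fineK ?fin_num_measure// -[RHS]fineK ?fin_num_measure//.
  congr EFin; rewrite -(cvg_lim _ (H mu1))// -(cvg_lim _ (H mu2))//.
  by under eq_fun do rewrite E//.
move=> A mA.
have := @measure_unique _ R (borel X) (@open X) (fun=> setT) erefl _ _ _ mu1 mu2 openE _ A mA; apply.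
- by move=> U V oU oV; exact: openI.
- by move=> _; exact: openT.
- by apply/seteqP; split => // x _; exists 0%N.
- by move=> _; rewrite ltey_eq fin_num_measure.
Qed.

End weak_convergence.

(** * Total variation and the mass of the meet *)

Section total_variation.
Context {d : measure_display} {T : measurableType d} {R : realType}.

Lemma tv_norm_ge_abs (mu nu : {finite_measure set T -> \bar R}) (A : set T) :
  measurable A -> (`|mu A - nu A| <= tv_norm (charge_diff mu nu))%E.
Proof.
move=> mA; rewrite /tv_norm.
move: (cid (Hahn_decomposition _)) => [P hP] /=; move: (cid _) => [N h] /=.
apply: (le_trans (abse_charge_variation h mA)).
by apply: le_measure; rewrite ?inE.
Qed.

(** An alias carrying the finiteness proof, so that a finite measure structure can be attached to
    it. *)
Definition fin_measure (m : {measure set T -> \bar R}) (mfin : fin_num_fun m) :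
  set T -> \bar R := m.

HB.instance Definition _ m mfin := Measure.on (@fin_measure m mfin).
HB.instance Definition _ m mfin :=
  @Measure_isFinite.Build _ _ _ (@fin_measure m mfin) mfin.

(* The candidate lower bound is [mu] on the negative part and [nu] on the
   positive part of a Hahn decomposition of [mu - nu]. *)
Lemma meet_mass_ge (mu nu : probability T R) (lam : {finite_measure set T -> \bar R})
    (r : R) :
  is_measure_meet mu nu lam -> (tv_norm (charge_diff mu nu) <= r%:E)%E ->
  ((1 - r)%:E <= lam setT)%E.
Proof.
move=> [_ _ lam_glb]; rewrite /tv_norm.
move: (cid (Hahn_decomposition _)) => [P hP] /=; move: (cid _) => [N h] /= tvr.
case: (h) => posP negN PN PN0.
have mP : measurable P by case: posP.
have mN : measurable N by case: negN.
pose k0 := measure_add (mrestr mu mN) (mrestr nu mP).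
have k0E A : k0 A = (mu (A `&` N) + nu (A `&` P))%E by rewrite /k0 measure_addE.
have k0fin : fin_num_fun k0.
  move=> A mA; rewrite k0E fin_numD !fin_num_measure//; exact: measurableI.
pose k : {finite_measure set T -> \bar R} := fin_measure k0fin.
have kE A : k A = (mu (A `&` N) + nu (A `&` P))%E by rewrite -k0E.
have splitA (m : probability T R) A : measurable A ->
    m A = (m (A `&` N) + m (A `&` P))%E.
  move=> mA; rewrite -measureU; [|exact: measurableI|exact: measurableI|].
    by rewrite -setIUr setUC PN setIT.
  by rewrite setIACA [N `&` P]setIC PN0 setI0.
have fin (m : probability T R) A : measurable A -> m A \is a fin_num.
  by move=> mA; rewrite fin_num_measure.
have nuP A : measurable A -> (nu (A `&` P) <= mu (A `&` P))%E.
  move=> mA; have mAP : measurable (A `&` P) by exact: measurableI.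
  by rewrite -sube_ge0 ?fin//; apply: posP.2 => //; exact: subIsetr.
have muN A : measurable A -> (mu (A `&` N) <= nu (A `&` N))%E.
  move=> mA; have mAN : measurable (A `&` N) by exact: measurableI.
  by rewrite -sube_le0 ?fin//; apply: negN.2 => //; exact: subIsetr.
have kmu : measure_le k mu.
  by move=> A mA; rewrite kE (splitA mu A mA) leeD2l// nuP.
have knu : measure_le k nu.
  by move=> A mA; rewrite kE (splitA nu A mA) leeD2r// muN.
apply: (le_trans _ (lam_glb k kmu knu setT measurableT)).
rewrite kE !setTI.
(* The candidate has mass mu N + nu P = 1 - (mu P - nu P), and the bracket is the positive
   variation. *)
have muPr : (mu P - nu P <= r%:E)%E.
  apply: le_trans tvr; rewrite /charge_variation /= jordan_posE cjordan_posE.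
  rewrite /crestr0 mem_set// /crestr setTI -[leLHS]adde0 leeD2l//.
have muT : (mu N + mu P = 1)%E.
  by have := splitA mu setT measurableT; rewrite !setTI (probability_setT mu).
move: muPr muT; rewrite -(fineK (fin mu N mN)) -(fineK (fin mu P mP)) -(fineK (fin nu P mP)).
rewrite -EFinB -!EFinD !lee_fin => ? [?]; lra.
Qed.

End total_variation.

(** * Integrals under comparable measures *)

Section measure_comparison.
Context {d : measure_display} {T : measurableType d} {R : realType}.

Lemma ge0_le_integrable (mu : {measure set T -> \bar R}) (f g : T -> R) :
  measurable_fun [set: T] f -> (forall x, 0 <= f x <= g x) ->
  mu.-integrable [set: T] (EFin \o g) -> mu.-integrable [set: T] (EFin \o f).
Proof.
move=> mf fg; apply: le_integrable => //; first exact/measurable_EFinP.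
move=> x _ /=; have /andP[f0 fgx] := fg x.
by rewrite lee_fin !ger0_norm// (le_trans f0).
Qed.

Lemma le_measure_integrable (m1 m2 : {measure set T -> \bar R}) (f : T -> \bar R) :
  measure_le m1 m2 -> m2.-integrable [set: T] f -> m1.-integrable [set: T] f.
Proof.
move=> m12 /integrableP[mf foo]; apply/integrableP; split=> //.
apply: le_lt_trans foo; apply: ge0_le_measure_integral => //.
exact: measurableT_comp.
Qed.

Lemma ge0_le_measure_Rintegral (m1 m2 : {measure set T -> \bar R}) (f : T -> R) :
  measure_le m1 m2 -> m2.-integrable [set: T] (EFin \o f) ->
  (forall x, 0 <= f x) -> \int[m1]_x f x <= \int[m2]_x f x.
Proof.
move=> m12 if2 f0; have if1 := le_measure_integrable m12 if2.
rewrite /Rintegral; apply: fine_le; [exact: integrable_fin_num|exact: integrable_fin_num|].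
apply: ge0_le_measure_integral => //; last by case/integrableP: if2.
Qed.

End measure_comparison.

(** * Measurability of distances *)

Section measurable_dist.
Context {R : realType} {X : completeMetricType R}.
Hypothesis X_separable : separable_space X.
Context {d : measure_display} {T : measurableType d}.

(** The distance is the infimum over a dense sequence of d(z_n, a) + d(z_n, b), so only Borel
    functions of one variable are needed, not Borel sets of X x X. *)
Lemma measurable_mdist (a b : T -> X) :
  measurable_fun [set: T] (a : T -> borel X) ->
  measurable_fun [set: T] (b : T -> borel X) ->
  measurable_fun [set: T] (fun t => mdist (a t) (b t)).
Proof.
move=> ma mb; have [z zd] := separable_enum (point : X) X_separable.
pose h n t := mdist (z n) (a t) + mdist (z n) (b t).
have h0 t : lbound (range (h ^~ t)) 0.
  by move=> _ [n _ <-]; rewrite addr_ge0// mdist_ge0.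
rewrite (_ : (fun t => _) = (fun t => infs (h ^~ t) 0%N)); last first.
  apply/funext => t; rewrite /infs; apply/eqP; rewrite eq_le; apply/andP; split.
    apply: lb_le_inf; first by exists (h 0%N t); exists 0%N.
    by move=> _ [n _ <-]; rewrite /h [mdist (z n) (a t)]metric_sym metric_triangle.
  apply/ler_addgt0Pr => e e0.
  have [n zn] := zd (a t) (e / 2) (divr_gt0 e0 (ltr0Sn _ _)).
  apply: (@le_trans _ _ (h n t)).
    apply: ge_inf; last by exists n.
    by exists 0 => _ [m _ <-]; apply: h0; exists m.
  rewrite /h; have := metric_triangle (z n) (a t) (b t).
  by rewrite [mdist (z n) (a t)]metric_sym; lra.
apply: measurable_fun_infs => [t _|n].
  by exists 0; exact: h0.
have md c : measurable_fun [set: borel X] ((fun x => mdist c x) : borel X -> R).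
  apply: continuous_borel_measurable; apply: (@lipschitz_continuous _ _ _ 1) => x y.
  by rewrite mul1r; exact: mdist_lipschitz.
by apply: measurable_funD; exact: measurableT_comp (md _) _.
Qed.

End measurable_dist.

(** * The coupling estimate *)

Section coupling.
Context {d : measure_display} {T : measurableType d} {R : realType}.

(* With [m] the common part of [P1] and [P2], the remainders [P1 - m] and
   [P2 - m] are compared through the constant [k] separating [a - u] from
   [b + v]; no product coupling is needed. *)
Lemma coupling_bound (P1 P2 : probability T R)
    (m : {finite_measure set T -> \bar R}) (a b u v psi : T -> R) (k r : R) :
  measure_le m P1 -> measure_le m P2 -> bmeas a -> bmeas b -> bmeas psi ->
  P1.-integrable [set: T] (EFin \o u) -> P2.-integrable [set: T] (EFin \o v) ->
  (forall t, a t - u t <= k) -> (forall t, k <= b t + v t) ->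
  (forall t, a t - b t <= u t + v t - r * psi t) ->
  \int[P1]_t a t - \int[P2]_t b t <=
    \int[P1]_t u t + \int[P2]_t v t - r * \int[m]_t psi t.
Proof.
move=> m1 m2 ba bb bpsi iu iv auk kbv abuv.
(* Both functions are nonnegative, so their integrals drop when P1 and P2 are replaced by m. In the
   sum f + g the constant k cancels, leaving u + v - (a - b) >= r psi. *)
pose f t := u t + (k - a t); pose g t := v t + (b t - k).
have bka : bmeas (fun t => k - a t).
  apply: bmeasD; first exact: bmeas_cst.
  have := bmeasM (bmeas_cst (-1)) ba.
  by congr bmeas; apply/funext => t; rewrite mulN1r.
have bbk : bmeas (fun t => b t - k) by apply: bmeasD => //; exact: bmeas_cst.
have f0 t : 0 <= f t by have := auk t; rewrite /f; lra.
have g0 t : 0 <= g t by have := kbv t; rewrite /g; lra.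
have if1 : P1.-integrable [set: T] (EFin \o f).
  rewrite (_ : _ \o _ = (EFin \o u) \+ (EFin \o (fun t => k - a t)))//.
  by apply: integrableD => //; exact: bmeas_integrable.
have ig2 : P2.-integrable [set: T] (EFin \o g).
  rewrite (_ : _ \o _ = (EFin \o v) \+ (EFin \o (fun t => b t - k)))//.
  by apply: integrableD => //; exact: bmeas_integrable.
have ifm := le_measure_integrable m1 if1.
have igm := le_measure_integrable m2 ig2.
have Ef : \int[P1]_t f t = \int[P1]_t u t + (k - \int[P1]_t a t).
  rewrite RintegralD//; last exact: bmeas_integrable.
  congr (_ + _); rewrite RintegralB//; last exact: bmeas_integrable.
    by rewrite Rintegral_probability_cst.
  by apply: bmeas_integrable; exact: bmeas_cst.
have Eg : \int[P2]_t g t = \int[P2]_t v t + (\int[P2]_t b t - k).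
  rewrite RintegralD//; last exact: bmeas_integrable.
  congr (_ + _); rewrite RintegralB//; last first.
  - by apply: bmeas_integrable; exact: bmeas_cst.
  - exact: bmeas_integrable.
  by rewrite Rintegral_probability_cst.
have fm := ge0_le_measure_Rintegral m1 if1 f0.
have gm := ge0_le_measure_Rintegral m2 ig2 g0.
have fgm : r * \int[m]_t psi t <= \int[m]_t f t + \int[m]_t g t.
  rewrite -RintegralZl_bmeas// -RintegralD//; apply: le_Rintegral => //.
  - apply: bmeas_integrable; apply: bmeasM => //; exact: bmeas_cst.
  - rewrite (_ : _ \o _ = (EFin \o f) \+ (EFin \o g))//; exact: integrableD.
  - by move=> t _; have := abuv t; rewrite /f /g; lra.
by lra.
Qed.

End coupling.

(** * Contraction of the Lipschitz constant for rho *)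

Section contraction.
Context {R : realType} {X : completeMetricType R}.
Hypothesis X_separable : separable_space X.
Context {d : measure_display} {Theta : measurableType d}.
Variables (vartheta : X -> probability Theta R) (S : Theta -> X -> X).
Hypothesis S_measurable : measurable_fun [set: Theta * borel X]
    ((fun p => S p.1 p.2) : Theta * borel X -> borel X).
Variable alpha : R.
Hypothesis alpha_itv : 0 < alpha < 1.
Hypothesis B1 : forall x y : X,
    (\int[vartheta x]_theta (mdist (S theta x) (S theta y))%:E
      <= (alpha * mdist x y)%:E)%E.
Variable xbar : X.
Hypothesis B2 : (ereal_sup [set \int[vartheta x]_theta (mdist (S theta xbar) xbar)%:E
                   | x in [set: X]] < +oo)%E.
Variables l nu : R.
Hypotheses (l_gt0 : 0 < l) (nu_itv : 0 < nu <= 1).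
Hypothesis B3 : forall x y : X,
    (tv_norm (charge_diff (vartheta x) (vartheta y))
      <= (l * mdist x y `^ nu)%:E)%E.
Variable delta : R.
Hypothesis delta_gt0 : 0 < delta.
Hypothesis B4 : forall x y : X, exists2 lam : {finite_measure set Theta -> \bar R},
    is_measure_meet (vartheta x) (vartheta y) lam &
    (delta%:E < lam [set theta | mdist (S theta x) (S theta y)
                                 <= alpha * mdist x y]%R)%E.
Local Notation P := (P_op vartheta S).
Local Notation V := (mdist xbar).

Let mS x : measurable_fun [set: Theta] ((fun t => S t x) : Theta -> borel X).
Proof. exact: S_measurable1. Qed.

Let mdS x y : measurable_fun [set: Theta] (fun t => mdist (S t x) (S t y)).
Proof. by apply: measurable_mdist. Qed.

Let mdc x c : measurable_fun [set: Theta] (fun t => mdist (S t x) c).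
Proof. by apply: measurable_mdist. Qed.

Let mcd c x : measurable_fun [set: Theta] (fun t => mdist c (S t x)).
Proof. by apply: measurable_mdist. Qed.

Lemma vartheta_tv x y (A : set Theta) : measurable A ->
  `|fine (vartheta x A) - fine (vartheta y A)| <= l * mdist x y `^ nu.
Proof.
move=> mA.
have E : (vartheta x A - vartheta y A =
    (fine (vartheta x A) - fine (vartheta y A))%:E)%E.
  by rewrite EFinB !fineK// fin_num_measure.
have : (`|vartheta x A - vartheta y A| <= (l * mdist x y `^ nu)%:E)%E.
  exact: le_trans (tv_norm_ge_abs (vartheta x) (vartheta y) mA) (B3 x y).
by rewrite E lee_fin.
Qed.

Lemma drift_bound : exists2 c, 0 <= c & forall x,
  (vartheta x).-integrable [set: Theta] (EFin \o (fun t => V (S t x))) /\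
  \int[vartheta x]_t V (S t x) <= alpha * V x + c.
Proof.
pose s := ereal_sup [set \int[vartheta x]_theta (mdist (S theta xbar) xbar)%:E
                   | x in [set: X]]%E.
have s_ub x : (\int[vartheta x]_theta (mdist (S theta xbar) xbar)%:E <= s)%E.
  by apply: ereal_sup_ubound; exists x.
have s0 : (0 <= s)%E.
  apply: le_trans (s_ub xbar); apply: integral_ge0 => t _.
  by rewrite lee_fin mdist_ge0.
have sfin : s \is a fin_num by rewrite ge0_fin_numE.
exists (fine s) => [|x]; first exact: fine_ge0.
have le : (\int[vartheta x]_t (V (S t x))%:E <= (alpha * V x + fine s)%:E)%E.
  rewrite EFinD fineK// [mdist xbar x]metric_sym.
  (* (B1) integrates against the measure of its first argument, so x comes first and xbar second; c
     is the supremum in (B2). *)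
  apply: le_trans (leeD (B1 x xbar) (s_ub x)).
  rewrite -ge0_integralD//.
  - apply: ge0_le_integral => //.
    + by move=> t _; rewrite lee_fin mdist_ge0.
    + exact/measurable_EFinP.
    + by apply/measurable_EFinP; apply: measurable_funD.
    + move=> t _; rewrite -EFinD lee_fin [mdist xbar _]metric_sym.
      exact: metric_triangle.
  - by move=> t _; rewrite lee_fin mdist_ge0.
  - exact/measurable_EFinP.
  - by move=> t _; rewrite lee_fin mdist_ge0.
  - exact/measurable_EFinP.
have int : (vartheta x).-integrable [set: Theta] (EFin \o (fun t => V (S t x))).
  apply/integrableP; split; first exact/measurable_EFinP.
  rewrite (eq_integral (fun t => (V (S t x))%:E)); last first.
    by move=> t _; rewrite /= ger0_norm ?mdist_ge0.
  by rewrite (le_lt_trans le)// ltey.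
split=> //; rewrite -lee_fin /Rintegral fineK//; exact: integrable_fin_num.
Qed.

Lemma decay_bmeas (p : nat) (K : R) x y : 1 <= K ->
  bmeas (fun t => decay p (K * mdist (S t x) (S t y) `^ nu)).
Proof.
move=> K1; have u0 t : 0 <= K * mdist (S t x) (S t y) `^ nu.
  by rewrite mulr_ge0 ?powR_ge0// (le_trans ler01).
split; last first.
  by exists 1 => t; rewrite ger0_norm ?decay_le1// ltW// decay_gt0.
apply: measurable_funX.
have mu1 : measurable_fun [set: Theta] (fun t => 1 + K * mdist (S t x) (S t y) `^ nu).
  apply: measurable_funD => //; apply: measurable_funM => //.
  exact: (measurableT_comp (measurable_powR nu) (mdS x y)).
have := measurableT_comp (measurable_powR (-1)) mu1.
apply: eq_measurable_fun => t _ /=.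
by rewrite powR_inv1// addr_ge0.
Qed.

Section pair.
Variables x y : X.
Hypothesis xy : 0 < mdist x y.
Variable m : {finite_measure set Theta -> \bar R}.
Hypothesis mx : measure_le m (vartheta x).
Variables (p : nat) (K : R).
Hypothesis K1 : 1 <= K.
Let u (z z' : X) := K * mdist z z' `^ nu.
(** The value of u at distance exactly alpha d(x, y). *)
Let t0 := alpha `^ nu * u x y.

Let u_ge0 z z' : 0 <= u z z'.
Proof. by rewrite mulr_ge0 ?powR_ge0// (le_trans ler01). Qed.

Let t0_ge0 : 0 <= t0. Proof. by rewrite mulr_ge0 ?powR_ge0. Qed.

Let uS_bmeas : bmeas (fun t => decay p (u (S t x) (S t y))).
Proof. exact: decay_bmeas. Qed.

(** As m may have mass below 1, Jensen's inequality is replaced by integrating a tangent. The ratio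
    r of the new distance to alpha d(x, y) has integral at most 1 by (B1). *)
Lemma decay_jensen :
  decay p t0 - (1 - fine (m setT)) <= \int[m]_t decay p (u (S t x) (S t y)).
Proof.
have /andP[nu0 nu1] := nu_itv; have /andP[a0 a1] := alpha_itv.
have ad0 : 0 < alpha * mdist x y by rewrite mulr_gt0.
pose r t := mdist (S t x) (S t y) / (alpha * mdist x y).
have r0 t : 0 <= r t by rewrite divr_ge0 ?mdist_ge0// ltW.
have uE t : u (S t x) (S t y) = r t `^ nu * t0.
  have -> : u (S t x) (S t y) = K * (r t * (alpha * mdist x y)) `^ nu.
    by rewrite /r divfK// gt_eqF.
  rewrite (powRM nu (r0 t) (ltW ad0)) (powRM nu (ltW a0) (ltW xy)) /t0 /u.
  by move: (r t `^ nu) => q; ring.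
have t1 : 0 < 1 + t0 by rewrite ltr_pwDl.
(* Minus the logarithmic slope at r = 1 of r -> decay(t0 r^nu). *)
pose c := p%:R * t0 * nu / (1 + t0).
have c0 : 0 <= c.
  apply: divr_ge0; last exact: ltW.
  by apply: mulr_ge0; [exact: mulr_ge0|exact: ltW].
have pw t : decay p t0 * (1 + c) - decay p t0 * c * r t <= decay p (u (S t x) (S t y)).
  rewrite (le_trans _ (decay_tangent p (u_ge0 _ _) t0_ge0))//.
  rewrite -mulrA -mulrBr ler_wpM2l ?(ltW (decay_gt0 _ _))//.
  have := powR_le_tangent (r0 t) nu_itv; rewrite uE.
  move: (r t `^ nu) => q rq.
  suff : p%:R * (q * t0 - t0) / (1 + t0) <= c * (r t - 1) by lra.
  have B0 : 0 <= p%:R * t0 / (1 + t0) by rewrite divr_ge0 ?(ltW t1)// mulr_ge0.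
  have := ler_wpM2l B0 (_ : q - 1 <= nu * (r t - 1)).
  rewrite /c; lra.
have int_r : (vartheta x).-integrable [set: Theta] (EFin \o r) /\ \int[vartheta x]_t r t <= 1.
  have intd : (vartheta x).-integrable [set: Theta] (EFin \o (fun t => mdist (S t x) (S t y))).
    apply/integrableP; split; first exact/measurable_EFinP.
    rewrite (eq_integral (fun t => (mdist (S t x) (S t y))%:E)); last first.
      by move=> t _; rewrite /= ger0_norm ?mdist_ge0.
    by rewrite (le_lt_trans (B1 x y))// ltey.
  have rE : r = fun t => (alpha * mdist x y)^-1 * mdist (S t x) (S t y).
    by apply/funext => t; rewrite /r mulrC.
  rewrite rE; split.
    rewrite (_ : _ \o _ = fun t => ((alpha * mdist x y)^-1%:E * (mdist (S t x) (S t y))%:E)%E)//.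
    exact: integrableZl.
  rewrite RintegralZl// ler_pdivrMl// mulr1 -lee_fin /Rintegral fineK.
    exact: B1.
  exact: (integrable_fin_num measurableT intd).
have [ir ir1] := int_r; have irm := le_measure_integrable mx ir.
have rm1 : \int[m]_t r t <= 1 by apply: le_trans ir1; exact: ge0_le_measure_Rintegral.
have mT1 : fine (m setT) <= 1.
  rewrite -lee_fin fineK ?fin_num_measure//.
  by rewrite (le_trans (mx measurableT))// (probability_setT (vartheta x)).
have bc e : bmeas (cst e : Theta -> R) by exact: bmeas_cst.
have irc : m.-integrable [set: Theta] (EFin \o (fun t => decay p t0 * c * r t)).
  rewrite (_ : _ \o _ = fun t => ((decay p t0 * c)%:E * (r t)%:E)%E)//.
  exact: integrableZl.
have ic : m.-integrable [set: Theta] (EFin \o cst (decay p t0 * (1 + c))).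
  exact: bmeas_integrable.
have : \int[m]_t (cst (decay p t0 * (1 + c)) t - decay p t0 * c * r t) <=
    \int[m]_t decay p (u (S t x) (S t y)).
  apply: le_Rintegral => //; last exact: bmeas_integrable.
  exact: (integrableB measurableT ic irc).
rewrite RintegralB// RintegralZl// Rintegral_cst//; apply: le_trans.
have w0 := decay_gt0 p t0_ge0.
have wc : decay p t0 * (1 + c) <= 1.
  apply: decay_mul_le1 => //; rewrite /c ler_pdivrMr//.
  apply: ler_wpM2l; first exact: mulr_ge0.
  by have := t0_ge0; lra.
have : decay p t0 * c * \int[m]_t r t <= decay p t0 * c * 1.
  by rewrite ler_wpM2l// mulr_ge0// ltW.
(* This product is the exact gap between the integrated tangent, with the integral of r replaced by
   1, and the claimed bound. *)
have : 0 <= (1 - fine (m setT)) * (1 - decay p t0 * (1 + c)).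
  by rewrite mulr_ge0// subr_ge0.
move: (\int[m]_t r t) => J; move: (fine _) => M; lra.
Qed.

Lemma decay_contracting_set :
  (delta%:E < m [set theta | mdist (S theta x) (S theta y) <= alpha * mdist x y]%R)%E ->
  delta * decay p t0 <= \int[m]_t decay p (u (S t x) (S t y)).
Proof.
set G := [set _ | _] => mG.
have /andP[nu0 nu1] := nu_itv; have /andP[a0 a1] := alpha_itv.
have measG : measurable G.
  rewrite (_ : G = setT `&` (fun t => mdist (S t x) (S t y)) @^-1` `]-oo, alpha * mdist x y]).
    exact: mdS.
  by rewrite setTI; apply/seteqP; split=> t; rewrite /G /= in_itv.
have pw t : decay p t0 * \1_G t <= decay p (u (S t x) (S t y)).
  rewrite indicE; have [Gt|Gt] := pselect (G t); last first.
    by rewrite memNset// mulr0 ltW// decay_gt0.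
  rewrite mem_set// mulr1 le_decay//.
  rewrite /t0 /u mulrCA ler_wpM2l ?(le_trans ler01)// -powRM ?mdist_ge0 ?(ltW a0)//.
  apply: ge0_ler_powR; rewrite ?nnegrE ?mdist_ge0 ?mulr_ge0 ?mdist_ge0 ?(ltW a0) ?(ltW nu0)//.
have : \int[m]_t (decay p t0 * \1_G t) <= \int[m]_t decay p (u (S t x) (S t y)).
  apply: le_Rintegral_bmeas => //; apply: bmeasM; first exact: bmeas_cst.
  exact: bmeas_indic.
apply: le_trans; rewrite RintegralZl_bmeas; last exact: bmeas_indic.
rewrite Rintegral_indic// mulrC ler_wpM2l ?(ltW (decay_gt0 _ _))//.
by rewrite -lee_fin fineK ?fin_num_measure// ltW.
Qed.

End pair.

Lemma P_op_contraction : exists (p : nat) (K eta q : R),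
  [/\ 1 <= K, 0 < eta, 0 < q < 1 &
  forall (f : X -> R) (A : R), bmeas (f : borel X -> R) -> 0 <= A ->
  (forall x y, f x - f y <= A * Num.sqrt ((1 - decay p.+1 (K * mdist x y `^ nu)) *
    (1 + eta * (V x + V y)))) ->
  forall x y, P f x - P f y <= q * A *
    Num.sqrt ((1 - decay p.+1 (K * mdist x y `^ nu)) * (1 + eta * (V x + V y)))].
Proof.
have /andP[nu0 nu1] := nu_itv; have /andP[a0 a1] := alpha_itv.
have [c c0 PV] := drift_bound.
have beta_itv : 0 < alpha `^ nu < 1.
  rewrite powR_gt0//=; have := gt0_ltr_powR nu0 (_ : alpha \in Num.nneg) (_ : 1 \in Num.nneg) a1.
  by rewrite powR1; apply; rewrite nnegrE// ltW.
have [p [K [k [K1 /andP[k0 k1] contr]]]] := decay_contraction beta_itv l_gt0 delta_gt0.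
(* The threshold on V x + V y between near and far pairs; the added 1 makes it positive even if c =
   0. *)
pose R0 := 4 * c / (1 - alpha) + 1.
have a10 : 0 < 1 - alpha by rewrite subr_gt0.
have R0_gt0 : 0 < R0 by rewrite ltr_wpDl// divr_ge0 ?(ltW a10)// mulr_ge0.
have R0c : 4 * c <= (1 - alpha) * R0.
  have -> : (1 - alpha) * R0 = 4 * c + (1 - alpha).
    by rewrite /R0; field; rewrite gt_eqF.
  by rewrite lerDl ltW.
pose U := K * R0 `^ nu.
have K0 : 0 < K by apply: lt_le_trans K1.
have U0 : 0 <= U by rewrite mulr_ge0 ?powR_ge0// ltW.
(* Near pairs satisfy u x y <= U, so kk bounds their gain for phi from below uniformly. *)
pose kk := Num.min (decay p.+1 U) k.
have kk0 : 0 < kk by rewrite lt_min decay_gt0.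
have kk1 : kk < 1 by rewrite gt_min k1 orbT.
have [eta [q [eta0 q01 rate_far rate_near]]] :=
  drift_rates alpha_itv c0 (introT andP (conj kk0 kk1)) R0_gt0 R0c.
exists p, K, eta, q; split => //.
move=> f A bf A0 fA x y.
have [->|xy] := eqVneq x y.
  by rewrite subrr; have /andP[/ltW q0 _] := q01; rewrite !mulr_ge0 ?sqrtr_ge0.
rewrite -mdist_gt0 in xy.
pose u (z z' : X) := K * mdist z z' `^ nu.
have u0 z z' : 0 <= u z z' by rewrite mulr_ge0 ?powR_ge0// ltW.
have uxy : 0 < u x y by rewrite mulr_gt0// powR_gt0.
pose W (z z' : X) := 1 + eta * (V z + V z').
have W0 z z' : 0 < W z z'.
  by rewrite ltr_pwDl// mulr_ge0 ?addr_ge0 ?mdist_ge0// ltW.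
pose phi z z' := 1 - decay p.+1 (u z z').
have phi0 z z' : 0 <= phi z z' by rewrite subr_ge0 decay_le1.
have phixy : 0 < phi x y by rewrite subr_gt0 decay_lt1.
rewrite -/(u x y) -/(phi x y) -/(W x y).
set rho := Num.sqrt _.
(* The AM-GM parameter giving equality at (x, y): s phi = W / s = rho. At the image pairs only the
   inequality is used. *)
pose s := Num.sqrt (W x y / phi x y).
have s0 : 0 < s by rewrite sqrtr_gt0 divr_gt0.
have sqs : s * s = W x y / phi x y.
  by rewrite -expr2 sqr_sqrtr// divr_ge0// ltW.
have sphi : s * phi x y = rho.
  rewrite -[X in s * X](ger0_norm (ltW phixy)) -sqrtr_sqr -sqrtrM ?divr_ge0 ?(ltW phixy) ?(ltW (W0 _ _))//.
  by congr Num.sqrt; field; rewrite gt_eqF.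
have sW : s^-1 * W x y = rho.
  have -> : W x y = s * s * phi x y by rewrite sqs divfK// gt_eqF.
  by rewrite -mulrA mulKf ?gt_eqF.
have [m [mx my mglb] mG] := B4 x y.
have mT1 : fine (m setT) <= 1.
  rewrite -lee_fin fineK ?fin_num_measure//.
  by rewrite -(probability_setT (vartheta x)); exact: mx.
have mT : 1 - fine (m setT) <= l / K * u x y.
  have := meet_mass_ge (And3 mx my mglb) (B3 x y).
  rewrite -(fineK (fin_num_measure m setT measurableT)) lee_fin.
  have -> : l / K * u x y = l * mdist x y `^ nu.
    by rewrite /u; field; rewrite gt_eqF.
  lra.
pose J := \int[m]_t decay p.+1 (u (S t x) (S t y)).
have J1 : 1 - J <= phi x y * (1 - Num.min (decay p.+1 (u x y)) k).
  apply: contr => //.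
  - apply: le_trans mT1.
    rewrite -[leRHS]mul1r -Rintegral_cst//; apply: le_Rintegral_bmeas.
    + exact: decay_bmeas.
    + exact: bmeas_cst.
    + by move=> t; exact: decay_le1.
  - apply: le_trans (decay_jensen xy mx p.+1 K1).
    by rewrite lerD2l lerN2.
  - exact: decay_contracting_set.
(* The bound A (s phi + W / s) / 2 written as g(z) + g(z') minus a multiple of decay, with the
   constant terms shared equally between the two points. *)
pose c1 := A * (s / 4 + (4 * s)^-1); pose c2 := A * ((2 * s)^-1 * eta).
pose g z := c1 + c2 * V z.
have fg z z' : f z - f z' <= g z + g z' - A * s / 2 * decay p.+1 (u z z').
  apply: (le_trans (fA z z')).
  apply: (le_trans (ler_wpM2l A0 (sqrt_amgm (phi0 z z') (ltW (W0 z z')) s0))).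
  rewrite /g /c1 /c2 /phi /W le_eqVlt; apply/orP; left; apply/eqP.
  by field; rewrite gt_eqF.
(* Dropping the decay term gives f - g <= f + g across any two points, so sup (f - g) separates
   them. *)
have [k' k'1 k'2] : exists2 k', (forall z, f z - g z <= k') & (forall z, k' <= f z + g z).
  have fg' z z' : f z - g z <= f z' + g z'.
    have : 0 <= A * s / 2 * decay p.+1 (u z z').
      by rewrite mulr_ge0 ?(ltW (decay_gt0 _ _))// divr_ge0// mulr_ge0// ltW.
    by have := fg z z'; lra.
  pose D := [set f z - g z | z in [set: X]].
  exists (sup D) => z.
    by apply: ub_le_sup; [exists (f z + g z) => _ [z' _ <-]; exact: fg'|exists z].
  by apply: ge_sup; [exists (f z - g z); exists z|move=> _ [z' _ <-]; exact: fg'].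
have intg z : (vartheta z).-integrable [set: Theta] (EFin \o (fun t => g (S t z))) /\
    \int[vartheta z]_t g (S t z) <= c1 + c2 * (alpha * V z + c).
  have [iV PVz] := PV z.
  have i1 : (vartheta z).-integrable [set: Theta] (EFin \o cst c1).
    by apply: bmeas_integrable; exact: bmeas_cst.
  have i2 : (vartheta z).-integrable [set: Theta] (EFin \o (fun t => c2 * V (S t z))).
    exact: (integrableZl measurableT c2 iV).
  split; first exact: (integrableD measurableT i1 i2).
  rewrite (RintegralD measurableT i1 i2) Rintegral_probability_cst lerD2l.
  rewrite RintegralZl// ler_wpM2l//.
  apply: mulr_ge0 => //; apply: mulr_ge0; last exact: ltW.
  by rewrite invr_ge0 mulr_ge0// ltW.
have [igx gx] := intg x; have [igy gy] := intg y.
have cb := @coupling_bound _ _ _ _ _ m _ _ _ _ _ k' (A * s / 2) mx my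
  (bmeas_comp_S S_measurable x bf) (bmeas_comp_S S_measurable y bf)
  (decay_bmeas p.+1 x y K1) igx igy (fun t => k'1 (S t x)) (fun t => k'2 (S t y))
  (fun t => fg (S t x) (S t y)).
rewrite -/(P f x) -/(P f y) -/J in cb.
pose Sg := V x + V y.
have Sg0 : 0 <= Sg by rewrite addr_ge0 ?mdist_ge0.
(* The integrals recombine into at most A / 2 (s (1 - J) + (1 + eta (alpha Sg + 2c)) / s). By the
   choice of s, the factor qa of phi and the factor qb of W are averaged. *)
have bound qa qb : 1 - J <= phi x y * qa -> 1 + eta * (alpha * Sg + 2 * c) <= qb * W x y ->
    P f x - P f y <= (qa + qb) / 2 * A * rho.
  move=> ha hb; apply: (le_trans cb).
  have e1 : s * (1 - J) <= rho * qa by rewrite -sphi -mulrA ler_wpM2l// ltW.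
  have e2 : s^-1 * (1 + eta * (alpha * Sg + 2 * c)) <= rho * qb.
    rewrite (_ : rho * qb = s^-1 * (qb * W x y)); last by rewrite -sW; ring.
    by rewrite ler_wpM2l// invr_ge0 ltW.
  have := ler_wpM2l A0 (lerD e1 e2).
  move: gx gy; rewrite /c1 /c2 !invfM /Sg.
  move: (\int[_]_t g (S t x)) (\int[_]_t g (S t y)) (V x) (V y) (s^-1) => I1 I2 v1 v2 si.
  lra.
have D_le : mdist x y <= Sg.
  by rewrite /Sg [V x]metric_sym; exact: metric_triangle.
have [SgR|/ltW SgR] := leP R0 Sg.
  rewrite (_ : q = (1 + (2 * q - 1)) / 2); last by field.
  apply: bound; last exact: rate_far.
  rewrite (le_trans J1)// ler_wpM2l ?(ltW phixy)// gerBl le_min.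
  by rewrite (ltW k0) (ltW (decay_gt0 _ _)).
rewrite (_ : q = (1 - kk + (2 * q - 1 + kk)) / 2); last by field.
apply: bound; last exact: rate_near.
rewrite (le_trans J1)// ler_wpM2l ?(ltW phixy)// lerD2l lerN2.
rewrite /kk le_min !ge_min lexx orbT andbT; apply/orP; left.
apply: le_decay; rewrite ?u0// ler_wpM2l ?(ltW K0)//.
apply: ge0_ler_powR; rewrite ?nnegrE ?mdist_ge0 ?(ltW nu0) ?(ltW R0_gt0)//.
exact: le_trans SgR.
Qed.

End contraction.

(** * Convergence of the iterates and the invariant measure *)

Section ergodicity.
Context {R : realType} {X : completeMetricType R}.
Hypothesis X_separable : separable_space X.
Context {d : measure_display} {Theta : measurableType d}.
Variables (vartheta : X -> probability Theta R) (S : Theta -> X -> X).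
Hypothesis S_measurable : measurable_fun [set: Theta * borel X]
    ((fun p => S p.1 p.2) : Theta * borel X -> borel X).
Hypothesis vartheta_measurable : forall A : set Theta, measurable A ->
  measurable_fun [set: borel X] ((fun x => vartheta x A) : borel X -> \bar R).
Local Notation P := (P_op vartheta S).
Variables (xbar : X) (alpha c : R).
Hypotheses (alpha_itv : 0 < alpha < 1) (c_ge0 : 0 <= c).
Local Notation V := (mdist xbar).
Hypothesis drift : forall x,
  (vartheta x).-integrable [set: Theta] (EFin \o (fun t => V (S t x))) /\
  \int[vartheta x]_t V (S t x) <= alpha * V x + c.
Variables (rho : X -> X -> R) (q eta : R).
Hypotheses (q_itv : 0 < q < 1) (eta_gt0 : 0 < eta).
Hypothesis rho_contraction : forall (f : X -> R) (A : R),
  bmeas (f : borel X -> R) -> 0 <= A ->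
  (forall x y, f x - f y <= A * rho x y) ->
  forall x y, P f x - P f y <= q * A * rho x y.
Hypothesis rho_min : forall x y, Num.min 2 (mdist x y) <= 4 * rho x y.
Hypothesis rho_max : forall x y, rho x y <= 1 + eta * (V x + V y).
Hypothesis rho_continuous : forall x e, 0 < e ->
  exists2 r, 0 < r & forall y, mdist x y < r -> rho x y < e /\ rho y x < e.

Let bP (f : X -> R) n : bmeas (f : borel X -> R) ->
  bmeas (iter n P f : borel X -> R).
Proof. exact: iter_P_op_bmeas. Qed.

Let bS (f : X -> R) x : bmeas (f : borel X -> R) -> bmeas (fun t => f (S t x)).
Proof. exact: bmeas_comp_S. Qed.

Let bM (f : X -> R) a : bmeas (f : borel X -> R) ->
  bmeas ((fun x => a * f x) : borel X -> R).
Proof. by move=> bf; apply: bmeasM => //; exact: bmeas_cst. Qed.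

Let iter_add (f g : X -> R) n : bmeas (f : borel X -> R) -> bmeas (g : borel X -> R) ->
  iter n P (fun x => f x + g x) = (fun x => iter n P f x + iter n P g x).
Proof.
move=> bf bg; elim: n => //= n ->; apply/funext => x.
by rewrite /P_op RintegralD_bmeas//; apply: bS; exact: bP.
Qed.

Let iter_scale (f : X -> R) a n : bmeas (f : borel X -> R) ->
  iter n P (fun x => a * f x) = (fun x => a * iter n P f x).
Proof.
move=> bf; elim: n => //= n ->; apply/funext => x.
by rewrite /P_op RintegralZl_bmeas//; apply: bS; exact: bP.
Qed.

Let iter_cst a n : iter n P (cst a) = cst a.
Proof.
elim: n => //= n ->; apply/funext => x.
by rewrite /P_op Rintegral_probability_cst.
Qed.

Let iter_le (f g : X -> R) n x : bmeas (f : borel X -> R) -> bmeas (g : borel X -> R) ->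
  (forall x, f x <= g x) -> iter n P f x <= iter n P g x.
Proof.
move=> bf bg fg; elim: n x => //= n ih x.
by apply: le_Rintegral_bmeas => //; apply: bS; exact: bP.
Qed.

(** The fixed point of v -> alpha v + c. *)
Let c' := c / (1 - alpha).

Let c'_ge0 : 0 <= c'.
Proof. by have /andP[a0 a1] := alpha_itv; rewrite divr_ge0// subr_ge0 ltW. Qed.

Let iter_affine (f : X -> R) a b n x : bmeas (f : borel X -> R) -> 0 <= a ->
  (forall x, f x <= a * V x + b) -> iter n P f x <= a * (V x + c') + b.
Proof.
move=> bf a0 fab; have /andP[al0 al1] := alpha_itv.
have al10 : 0 < 1 - alpha by rewrite subr_gt0.
have : iter n P f x <= a * alpha ^+ n * V x + (a * c' * (1 - alpha ^+ n) + b).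
  elim: n x => [|n ih] x; first by rewrite expr0 /= mulr1 subrr mulr0 add0r.
  set a' := a * alpha ^+ n in ih *.
  set b' := a * c' * (1 - alpha ^+ n) + b in ih *.
  have a'0 : 0 <= a' by rewrite mulr_ge0// exprn_ge0// ltW.
  have [iV PV] := drift x.
  have i1 : (vartheta x).-integrable [set: Theta] (EFin \o cst b').
    by apply: bmeas_integrable; exact: bmeas_cst.
  have i2 : (vartheta x).-integrable [set: Theta] (EFin \o (fun t => a' * V (S t x))).
    exact: (integrableZl measurableT a' iV).
  rewrite iterS /P_op.
  apply: (@le_trans _ _ (\int[vartheta x]_t (a' * V (S t x) + cst b' t))).
    apply: le_Rintegral => //.
    - by apply: bmeas_integrable; apply: bS; exact: bP.
    - exact: (integrableD measurableT i2 i1).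
  have -> : \int[vartheta x]_t (a' * V (S t x) + cst b' t) =
      a' * \int[vartheta x]_t V (S t x) + b'.
    by rewrite RintegralD// RintegralZl// Rintegral_probability_cst.
  have := ler_wpM2l a'0 PV; rewrite /a' /b' exprSr.
  have -> : c = c' * (1 - alpha) by rewrite /c' divfK// gt_eqF.
  move: (\int[_]_t _) (alpha ^+ n) => I e; lra.
move=> /le_trans; apply.
have e1 : alpha ^+ n <= 1 by apply: exprn_ile1; exact: ltW.
have e0 : 0 <= alpha ^+ n by apply: exprn_ge0; exact: ltW.
have h1 : a * V x * alpha ^+ n <= a * V x * 1.
  by rewrite ler_wpM2l// mulr_ge0// mdist_ge0.
have h2 : 0 <= a * c' * alpha ^+ n by apply: mulr_ge0 => //; exact: mulr_ge0.
lra.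
Qed.

Let iter_contraction (f : X -> R) A n : bmeas (f : borel X -> R) -> 0 <= A ->
  (forall x y, f x - f y <= A * rho x y) ->
  forall x y, iter n P f x - iter n P f y <= q ^+ n * A * rho x y.
Proof.
have /andP[q0 _] := q_itv.
move=> bf A0 fA; elim: n => [|n ih] x y; first by rewrite expr0 mul1r.
rewrite exprS -[q * q ^+ n * A]mulrA; apply: rho_contraction; first exact: bP.
  by rewrite mulr_ge0// exprn_ge0// ltW.
exact: ih.
Qed.

(** The constant of [blip] is kept explicit because rates must depend on f through it only. *)
Definition lipbound (M : R) (f : X -> R) :=
  forall x, `|f x| <= M /\ forall y, `|f x - f y| <= M * mdist x y.

Let lipbound_blip M f : lipbound M f -> blip f.
Proof. by move=> fM; exists M. Qed.

Let lipbound_bmeas M f : lipbound M f -> bmeas (f : borel X -> R).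
Proof. by move=> /lipbound_blip; exact: blip_bmeas. Qed.

Let lipbound_ge0 M f : lipbound M f -> 0 <= M.
Proof. by move=> /(_ point)[+ _]; apply: le_trans. Qed.

(** The oscillation of f is at most M min(2, d), and the factor 4 is that of [rho_min]. *)
Let lipbound_rho M f : lipbound M f -> forall x y, f x - f y <= M * 4 * rho x y.
Proof.
move=> fM x y; have M0 := lipbound_ge0 fM.
rewrite -mulrA (le_trans _ (ler_wpM2l M0 (rho_min x y)))//.
have := ler_norm (f x - f y); have := (fM x).2 y.
have := (fM x).1; have := (fM y).1; rewrite !ler_norml => /andP[? ?] /andP[? ?] ? ?.
by case: (leP 2 (mdist x y)) => ?; lra.
Qed.

(** The contraction bounds the oscillation of P^n f by an affine function of V, which P^m preserves
    by the drift. Two base points give at once the Cauchy property and a limit independent of the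
    starting point. *)
Let iter_cauchy M f n m x x' : lipbound M f ->
  `|iter n P f x - iter (m + n) P f x'| <=
    M * 4 * q ^+ n * (1 + eta * (V x + (V x' + c'))).
Proof.
move=> fM; have bf := lipbound_bmeas fM; have M0 := lipbound_ge0 fM.
have /andP[q0 _] := q_itv.
have M4 : 0 <= M * 4 by rewrite mulr_ge0.
pose g := iter n P f; have bg : bmeas (g : borel X -> R) by exact: bP.
pose e := M * 4 * q ^+ n.
have e0 : 0 <= e by rewrite mulr_ge0// exprn_ge0// ltW.
have gc := iter_contraction n bf M4 (lipbound_rho fM).
have gab y z : g y - g z <= e * (1 + eta * (V y + V z)).
  rewrite (le_trans (gc y z))// [q ^+ n * _]mulrC ler_wpM2l//.
have ee0 : 0 <= e * eta by rewrite mulr_ge0// ltW.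
rewrite ssrnat.iterD -/g -/e ler_norml; apply/andP; split.
  have : iter m P g x' <= e * eta * (V x' + c') + (g x + e * (1 + eta * V x)).
    by apply: iter_affine => // y; have := gab y x; lra.
  by lra.
have : iter m P (fun y => -1 * g y) x' <=
    e * eta * (V x' + c') + (- g x + e * (1 + eta * V x)).
  apply: iter_affine => //; first exact: bM.
  by move=> y; have := gab x y; lra.
by rewrite iter_scale//; lra.
Qed.

Definition limit_functional (f : X -> R) : R := lim (iter n P f xbar @[n --> \oo]).
Local Notation L := limit_functional.

Let q_cvg0 (C : R) : C * q ^+ n @[n --> \oo] --> (0 : R).
Proof.
have /andP[q0 q1] := q_itv.
rewrite -[X in _ --> X](mulr0 C); apply: cvgM; first exact: cvg_cst.
by apply: cvg_expr; rewrite ger0_norm// ltW.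
Qed.

Let iter_cvg M f : lipbound M f -> iter n P f xbar @[n --> \oo] --> L f.
Proof.
move=> fM; have /andP[q0 q1] := q_itv.
apply: (@cauchy_cvg R^o); apply: cauchy_exP => e e0.
pose C := M * 4 * (1 + eta * (V xbar + (V xbar + c'))).
have /cvgrPdist_lt/(_ e e0)[N _ NP] := q_cvg0 C.
exists (iter N P f xbar); exists N => // n /= Nn.
rewrite -ball_normE /= -(subnK Nn).
rewrite (le_lt_trans (iter_cauchy N (n - N) xbar xbar fM))//.
have := NP N (leqnn N); rewrite /= sub0r normrN; apply: le_lt_trans.
by rewrite (le_trans _ (ler_norm _))// /C mulrAC.
Qed.

Let iter_limit M f n x : lipbound M f ->
  `|iter n P f x - L f| <= M * 4 * q ^+ n * (1 + eta * (V x + c')).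
Proof.
move=> fM; have bd m := iter_cauchy n m x xbar fM.
have cv : iter (m + n) P f xbar @[m --> \oo] --> L f.
  by have := iter_cvg fM; rewrite -(cvg_shiftn n).
have cvd : `|iter n P f x - iter (m + n) P f xbar| @[m --> \oo] --> `|iter n P f x - L f|.
  by apply: cvg_norm; apply: cvgB => //; exact: cvg_cst.
rewrite -(cvg_lim _ cvd)//; apply: limr_le; first exact: cvgP cvd.
by apply: nearW => m; rewrite (le_trans (bd m))// mdistxx add0r.
Qed.

Let iter_cvg_pt M f x : lipbound M f -> iter n P f x @[n --> \oo] --> L f.
Proof.
move=> fM; apply/cvgrPdist_le => /= e e0.
have /cvgrPdist_le/(_ e e0) := q_cvg0 (M * 4 * (1 + eta * (V x + c'))).
apply: filterS => n; rewrite sub0r normrN => h.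
rewrite distrC (le_trans (iter_limit n x fM))// (le_trans _ h)//.
by rewrite (le_trans _ (ler_norm _))// mulrAC.
Qed.

Let iter_bound M f n x : bmeas (f : borel X -> R) -> (forall y, `|f y| <= M) ->
  `|iter n P f x| <= M.
Proof.
move=> bf fM; rewrite ler_norml; apply/andP; split.
  rewrite -[leLHS]/((cst (- M) : X -> R) x) -(iter_cst (- M) n).
  apply: iter_le => //; first exact: bmeas_cst.
  by move=> y; have := fM y; rewrite ler_norml => /andP[].
rewrite -[leRHS]/((cst M : X -> R) x) -(iter_cst M n).
apply: iter_le => //; first exact: bmeas_cst.
by move=> y; have := fM y; rewrite ler_norml => /andP[].
Qed.

Let L_unique f a : iter n P f xbar @[n --> \oo] --> a -> L f = a.
Proof. by move=> fa; apply/cvg_lim. Qed.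

Let blip_lipbound f : blip f -> exists M, lipbound M f.
Proof. by []. Qed.

Let LD f g : blip f -> blip g -> L (fun x => f x + g x) = L f + L g.
Proof.
move=> bf bg; have [M fM] := blip_lipbound bf; have [N gN] := blip_lipbound bg.
apply: L_unique; under eq_fun do rewrite (iter_add _ (blip_bmeas bf) (blip_bmeas bg)).
by apply: cvgD; [exact: iter_cvg fM|exact: iter_cvg gN].
Qed.

Let LZ a f : blip f -> L (fun x => a * f x) = a * L f.
Proof.
move=> bf; have [M fM] := blip_lipbound bf.
apply: L_unique; under eq_fun do rewrite (iter_scale _ _ (blip_bmeas bf)).
by apply: cvgM; [exact: cvg_cst|exact: iter_cvg fM].
Qed.

Let L1 : L (cst 1) = 1.
Proof. by apply: L_unique; under eq_fun do rewrite iter_cst; exact: cvg_cst. Qed.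

Let L_ge0 f : blip f -> (forall x, 0 <= f x) -> 0 <= L f.
Proof.
move=> bf f0; have [M fM] := blip_lipbound bf.
rewrite -(cvg_lim _ (iter_cvg fM))//; apply: limr_ge; first exact: cvgP (iter_cvg fM).
apply: nearW => n; rewrite -[leLHS]/((cst 0 : X -> R) xbar) -(iter_cst 0 n).
by apply: iter_le => //; [exact: bmeas_cst|exact: blip_bmeas].
Qed.

Let iter_dirac (n : nat) : exists m : probability (borel X) R,
  forall f : X -> R, bmeas (f : borel X -> R) -> \int[m]_x f x = iter n P f xbar.
Proof.
have [m [_ mP]] := iter_P_dual_probability S_measurable vartheta_measurable
  (\d_(xbar : borel X)) n.
exists m => f bf; rewrite mP// /Rintegral integral_dirac//.
  by rewrite diracT mul1e.
by apply/measurable_EFinP; exact: (bP n bf).1.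
Qed.

(** The error |P^n f_k(xbar) - L f_k| <= C q^n is uniform in k. With n fixed, bounded convergence
    under the law of the chain at time n started at xbar handles P^n f_k(xbar). *)
Let L_equilip (f : nat -> X -> R) (M : R) :
  (forall k x, 0 <= f k x <= 1) ->
  (forall k x y, `|f k x - f k y| <= M * mdist x y) ->
  (forall k x, f k.+1 x <= f k x) ->
  (forall x (e : R), 0 < e -> exists k, f k x < e) ->
  forall e : R, 0 < e -> exists k, L (f k) < e.
Proof.
move=> f01 fM fS f0 e e0.
have fabs k x : `|f k x| <= 1 by have /andP[? ?] := f01 k x; rewrite ger0_norm.
pose M' := 1 + `|M|.
have M'1 : 1 <= M' by rewrite lerDl.
have fM' k : lipbound M' (f k).
  move=> x; split=> [|y]; first by rewrite (le_trans (fabs k x)).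
  rewrite (le_trans (fM k x y))// ler_wpM2r ?mdist_ge0//.
  by rewrite (le_trans (ler_norm M))// lerDr.
pose C := M' * 4 * (1 + eta * (V xbar + c')).
have e2 : 0 < e / 2 by rewrite divr_gt0.
have /cvgrPdist_lt/(_ _ e2)[n _ nP] := q_cvg0 C.
have nC : C * q ^+ n < e / 2.
  have := nP n (leqnn n); rewrite /= sub0r normrN; apply: le_lt_trans.
  exact: ler_norm.
have [m mP] := iter_dirac n.
have fk x : f k x @[k --> \oo] --> (0 : R).
  apply/cvgrPdist_le => /= r r0; have [K KP] := f0 x r r0.
  exists K => // k /= Kk; rewrite sub0r normrN ger0_norm; last by case/andP: (f01 k x).
  apply: le_trans (ltW KP).
  have hm : {homo f ^~ x : i j / (i <= j)%N >-> j <= i}.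
    by apply: homo_leq => [//|i j h ij jk|i]; [exact: le_trans jk ij|exact: fS].
  exact: hm.
have [_ int0] := @bounded_cvg_Rintegral _ (borel X) R m f (cst 0) 1
  (fun k => (lipbound_bmeas (fM' k)).1) fabs fk.
rewrite Rintegral_probability_cst in int0.
have /cvgrPdist_lt/(_ _ e2)[k _ kP] := int0.
exists k; have := kP k (leqnn k).
rewrite /= sub0r normrN mP; last exact: lipbound_bmeas (fM' k).
have := iter_limit n xbar (fM' k); rewrite mulrAC -/C ler_norml => /andP[h1 _] h2.
by have := ler_norm (iter n P (f k) xbar); lra.
Qed.

Let mu_star_exists : exists mu : probability (borel X) R,
  forall f, blip f -> \int[mu]_x f x = L f.
Proof. exact: daniell_representation. Qed.

Let attractive (mu_star : probability (borel X) R) :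
  (forall f, blip f -> \int[mu_star]_x f x = L f) ->
  attractive_measure vartheta S mu_star.
Proof.
move=> mu_starE f mu Cf.
have [m mP] : {m : nat -> probability (borel X) R & forall n,
    forall f : X -> R, bmeas (f : borel X -> R) ->
    \int[m n]_x f x = \int[mu]_x iter n P f x}.
  apply: (@choice _ _ (fun n (m : probability (borel X) R) =>
    forall f : X -> R, bmeas (f : borel X -> R) ->
    \int[m]_x f x = \int[mu]_x iter n P f x)) => n.
  have [m [_ mP]] := iter_P_dual_probability S_measurable vartheta_measurable mu n.
  by exists m.
under eq_fun do rewrite -(mP _ f (Cb_bmeas Cf)).
apply: blip_cvg_Cb => // g bg.
under eq_fun do rewrite (mP _ g (blip_bmeas bg)).
rewrite mu_starE// -(Rintegral_probability_cst mu (L g)).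
have [M gM] := blip_lipbound bg.
have [_] := @bounded_cvg_Rintegral _ (borel X) R mu (fun n => iter n P g) (cst (L g)) M
  (fun n => (bP n (blip_bmeas bg)).1)
  (fun n x => iter_bound n x (blip_bmeas bg) (fun y => (gM y).1))
  (fun x => iter_cvg_pt x gM).
by [].
Qed.

(** P f inherits a bound in terms of rho rather than d, so it is shown to be continuous instead of
    Lipschitz; attractivity tests against all of [Cb]. *)
Let P_Cb M f : lipbound M f -> Cb (P f).
Proof.
move=> fM; have bf := lipbound_bmeas fM.
have M4 : 0 <= M * 4 by rewrite mulr_ge0// (lipbound_ge0 fM).
have /andP[q0 q1] := q_itv.
have Pc := rho_contraction bf M4 (lipbound_rho fM).
split; last first.
  exists M; split; first exact: num_real.
  move=> N MN x _ /=; rewrite (le_trans _ (ltW MN))//.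
  exact: (iter_bound 1 x bf (fun y => (fM y).1)).
move=> x; apply/cvgrPdist_le => /= e e0.
(* The added 1 keeps the divisor positive when M = 0. *)
have A0 : 0 < q * (M * 4) + 1 by rewrite ltr_wpDl// mulr_ge0// ltW.
have [r r0 rP] := rho_continuous x (divr_gt0 e0 A0).
apply/nbhs_ballP; exists r => //= y; rewrite ballEmdist /= => /rP[h1 h2].
have k (a : R) : a < e / (q * (M * 4) + 1) -> q * (M * 4) * a <= e.
  move=> /ltW h; have : q * (M * 4) * a <= q * (M * 4) * (e / (q * (M * 4) + 1)).
    by rewrite ler_wpM2l// mulr_ge0// ltW.
  move=> /le_trans; apply; rewrite mulrCA ler_piMr ?(ltW e0)//.
  by rewrite ler_pdivrMr// mul1r lerDl.
have := k _ h1; have := k _ h2; have := Pc x y; have := Pc y x.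
by rewrite ler_norml => *; apply/andP; split; lra.
Qed.

(** Attractivity from the Dirac mass at xbar, tested on P f, makes the integral of P f the limit of
    P^(n+1) f(xbar), which is L f. *)
Let invariant (mu_star : probability (borel X) R) :
  (forall f, blip f -> \int[mu_star]_x f x = L f) ->
  invariant_measure vartheta S mu_star.
Proof.
move=> mu_starE A mA.
have [m [mA' mP]] := P_dual_probability S_measurable vartheta_measurable mu_star.
rewrite -mA'//; apply: eq_probability_blip => // f bf.
have [M fM] := blip_lipbound bf.
rewrite mP; last exact: blip_bmeas.
rewrite [RHS]mu_starE//.
have := attractive mu_starE (\d_(xbar : borel X)) (P_Cb fM).
have E n : \int[\d_(xbar : borel X)]_x (iter n P (P f) x) = iter n.+1 P f xbar.
  rewrite /Rintegral integral_dirac//; first by rewrite diracT mul1e iterSr.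
  by apply/measurable_EFinP; rewrite -iterSr; exact: (bP n.+1 (blip_bmeas bf)).1.
under eq_fun do rewrite E.
move=> /cvg_lim <-//; apply/cvg_lim => //.
by have := iter_cvg fM; rewrite -cvg_shiftS.
Qed.

Let unique (mu_star mu : probability (borel X) R) :
  (forall f, blip f -> \int[mu_star]_x f x = L f) ->
  invariant_measure vartheta S mu ->
  forall A : set (borel X), measurable A -> mu A = mu_star A.
Proof.
move=> mu_starE inv; apply: eq_probability_blip => f bf.
have [m [mA mP]] := P_dual_probability S_measurable vartheta_measurable mu.
have step g : bmeas (g : borel X -> R) -> \int[mu]_x P g x = \int[mu]_x g x.
  move=> bg; rewrite -mP//; congr fine; apply: integral_congr_measurable => B mB.
  by have := mA B mB; rewrite inv.
have steps n : \int[mu]_x iter n P f x = \int[mu]_x f x.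
  by elim: n => //= n <-; apply: step; apply: bP; exact: blip_bmeas.
have Cf : Cb f.
  split; first exact: blip_continuous.
  have [M fM] := blip_bounded bf; exists M; split; first exact: num_real.
  by move=> N MN x _ /=; rewrite (le_trans (fM x))// ltW.
have := attractive mu_starE mu Cf.
under eq_fun do rewrite steps.
by move=> /cvg_lim <-//; rewrite lim_cst.
Qed.

(** The truncations min(k, V) are bounded Lipschitz, and the drift started at xbar bounds L of them
    by c' uniformly in k; monotone convergence concludes. *)
Let moment (mu_star : probability (borel X) R) :
  (forall f, blip f -> \int[mu_star]_x f x = L f) -> M11 mu_star.
Proof.
move=> mu_starE; exists xbar.
pose f (k : nat) x : R := Num.min k%:R (V x).
have fM k : lipbound (1 + k%:R) (f k).
  move=> x; have Vx := mdist_ge0 xbar x; split=> [|y].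
    rewrite ger0_norm; last by rewrite le_min ler0n Vx.
    by rewrite ge_min lerDr ler01.
  have := mdist_lipschitz xbar x y; have := mdist_ge0 x y.
  have := mulr_ge0 (ler0n R k) (mdist_ge0 x y).
  rewrite !ler_norml /f mulrDl mul1r => h1 h2 /andP[h3 h4]; apply/andP.
  by case: (leP k%:R (V x)) => ?; case: (leP k%:R (V y)) => ?; split; lra.
have Lf k : L (f k) <= c'.
  rewrite -(cvg_lim _ (iter_cvg (fM k)))//; apply: limr_le.
    exact: cvgP (iter_cvg (fM k)).
  apply: nearW => n.
  have : iter n P (f k) xbar <= 1 * (V xbar + c') + 0.
    apply: iter_affine => //; first exact: lipbound_bmeas (fM k).
    by move=> x; rewrite mul1r addr0 ge_min lexx orbT.
  by rewrite mdistxx mul1r addr0 add0r.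
have intf k : (\int[mu_star]_x (f k x)%:E <= c'%:E)%E.
  rewrite Rintegral_EFin; last exact: lipbound_bmeas (fM k).
  by rewrite lee_fin mu_starE//; exact: lipbound_blip (fM k).
have mf k : measurable_fun [set: borel X] (fun x : borel X => (f k x)%:E).
  by apply/measurable_EFinP; exact: (lipbound_bmeas (fM k)).1.
have limf x : (f k x)%:E @[k --> \oo] --> (V x)%:E.
  apply: cvg_near_cst; near=> k; rewrite /f min_r//.
  by near: k; exact: nbhs_infty_ger.
have -> : (\int[mu_star]_x (V x)%:E = \int[mu_star]_x lim ((f k x)%:E @[k --> \oo]))%E.
  by apply: eq_integral => x _; rewrite (cvg_lim _ (limf x)).
rewrite monotone_convergence//; last 2 first.
- by move=> k x _; rewrite lee_fin le_min ler0n mdist_ge0.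
- move=> x _ i j ij; rewrite lee_fin /f le_min ge_min ler_nat ij/=.
  by rewrite ge_min lexx orbT.
apply: (@le_lt_trans _ _ c'%:E); last by rewrite ltry.
apply: lime_le; last by apply: nearW => k; exact: intf.
apply: ereal_nondecreasing_is_cvgn => i j ij; apply: ge0_le_integral => //.
- by move=> x _; rewrite lee_fin le_min ler0n mdist_ge0.
- move=> x _; rewrite lee_fin /f le_min ge_min ler_nat ij/=.
  by rewrite ge_min lexx orbT.
Unshelve. all: by end_near. Qed.

(** Integrate the pointwise bound 4 q^n (1 + eta (V + c')), valid since the test functions have
    constant 1. The prefactor comes from 1 + eta c' + eta v <= (1 + eta c' + eta) (1 + v). *)
Let rate (mu_star mu : probability (borel X) R) n :
  (forall f, blip f -> \int[mu_star]_x f x = L f) -> M11 mu ->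
  (FM_dist (iter n (P_dual vartheta S) mu) mu_star
    <= (q ^+ n * (4 * (1 + eta * c' + eta)))%:E *
      (1 + \int[mu]_x (mdist xbar x)%:E))%E.
Proof.
move=> mu_starE [x0 x0mu].
have /andP[q0 q1] := q_itv.
have md z : measurable_fun [set: borel X] (fun x : borel X => mdist z x).
  apply: continuous_borel_measurable; apply: (@lipschitz_continuous _ _ _ 1) => x y.
  by rewrite mul1r; exact: mdist_lipschitz.
have iV : mu.-integrable [set: borel X] (EFin \o (fun x : X => V x)).
  apply: (@ge0_le_integrable _ (borel X) R mu _ (fun x : X => mdist xbar x0 + mdist x0 x)).
  - exact: md.
  - by move=> x; rewrite mdist_ge0 metric_triangle.
  - have i1 : mu.-integrable [set: borel X] (EFin \o cst (mdist xbar x0)).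
      by apply: bmeas_integrable; exact: bmeas_cst.
    have i2 : mu.-integrable [set: borel X] (EFin \o (fun x : X => mdist x0 x)).
      apply/integrableP; split; first by apply/measurable_EFinP; exact: md.
      rewrite (eq_integral (fun x : borel X => (mdist x0 x)%:E))// => x _.
      by rewrite /= ger0_norm ?mdist_ge0.
    exact: (integrableD measurableT i1 i2).
pose v := \int[mu]_x V x.
have vE : (\int[mu]_x (V x)%:E = v%:E)%E.
  by rewrite /v /Rintegral fineK// (integrable_fin_num measurableT iV).
have v0 : 0 <= v by apply: Rintegral_ge0 => x _; exact: mdist_ge0.
rewrite vE -EFinD -EFinM.
apply: ge_ereal_sup => _ [f [Cf f1] <-].
have fM : lipbound 1 f.
  by move=> x; split=> [|y]; [exact: (f1 x x).2|rewrite mul1r; exact: (f1 x y).1].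
have bf := lipbound_bmeas fM.
have [m [mA mP]] := iter_P_dual_probability S_measurable vartheta_measurable mu n.
rewrite -(integral_congr_measurable _ mA) !Rintegral_EFin// -EFinB lee_fin.
rewrite mP// mu_starE; last exact: lipbound_blip fM.
have bn := bP n bf.
have -> : \int[mu]_x iter n P f x - L f = \int[mu]_x (iter n P f x - cst (L f) x).
  rewrite RintegralB//; last 2 first.
  - exact: bmeas_integrable.
  - by apply: bmeas_integrable; exact: bmeas_cst.
  by rewrite Rintegral_probability_cst.
have bd : bmeas ((fun x => iter n P f x - cst (L f) x) : borel X -> R).
  apply: bmeasD => //; exact: (@bmeas_cst _ (borel X) R (- L f)).
apply: (le_trans (le_normr_Rintegral _ _)) => //; first exact: bmeas_integrable.
pose a := 1 * 4 * q ^+ n.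
have a0 : 0 <= a by rewrite mulr_ge0// exprn_ge0// ltW.
have i1 : mu.-integrable [set: borel X] (EFin \o cst (a * (1 + eta * c'))).
  by apply: bmeas_integrable; exact: bmeas_cst.
have i2 : mu.-integrable [set: borel X] (EFin \o (fun x : X => a * eta * V x)).
  exact: (integrableZl measurableT (a * eta) iV).
apply: (@le_trans _ _ (\int[mu]_x (cst (a * (1 + eta * c')) x + a * eta * V x))).
  apply: le_Rintegral => //.
  - by apply: integrable_norm; exact: bmeas_integrable.
  - exact: (integrableD measurableT i1 i2).
  - by move=> x _; have := iter_limit n x fM; rewrite -/a /=; lra.
rewrite (RintegralD measurableT i1 i2) Rintegral_probability_cst RintegralZl// -/v.
have ae : 0 <= a * eta by rewrite mulr_ge0// ltW.
have h1 : 0 <= a * (1 + eta * c') * v.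
  by rewrite mulr_ge0// mulr_ge0// addr_ge0// mulr_ge0// ltW.
have -> : q ^+ n * (4 * (1 + eta * c' + eta)) * (1 + v) =
    a * (1 + eta * c' + eta) * (1 + v) by rewrite /a; ring.
by move: (a) (c') (v) h1 ae => *; lra.
Qed.

Theorem exponential_ergodicity : exists mu_star : probability (borel X) R,
    [/\ invariant_measure vartheta S mu_star,
        forall mu : probability (borel X) R, invariant_measure vartheta S mu ->
          forall A : set (borel X), measurable A -> mu A = mu_star A,
        M11 mu_star,
        attractive_measure vartheta S mu_star &
        exists q C : R, [/\ 0 < q < 1, 0 < C &
          forall (mu : probability (borel X) R) (n : nat), M11 mu ->
            (FM_dist (iter n (P_dual vartheta S) mu) mu_star
              <= (q ^+ n * C)%:E * (1 + \int[mu]_x (mdist xbar x)%:E))%E]].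
Proof.
have [mu_star mu_starE] := mu_star_exists; exists mu_star; split.
- exact: invariant.
- by move=> mu inv; exact: unique.
- exact: moment.
- exact: attractive.
- exists q, (4 * (1 + eta * c' + eta)); split => //.
    by rewrite mulr_gt0// ltr_wpDl// addr_ge0// mulr_ge0// ltW.
  by move=> mu n muM; exact: rate.
Qed.

End ergodicity.

(** * Comparison of rho with the distance *)

Section rho.
Context {R : realType}.

Lemma powR_small (nu t : R) : 0 < nu -> 0 < t ->
  exists2 r, 0 < r & forall D, 0 <= D -> D < r -> D `^ nu < t.
Proof.
move=> nu0 t0; exists (t `^ nu^-1) => [|D D0 Dr]; first exact: powR_gt0.
have -> : t = (t `^ nu^-1) `^ nu by rewrite -powRrM mulVf ?powRr1 ?gt_eqF// ltW.
by apply: gt0_ltr_powR => //; rewrite nnegrE// powR_ge0.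
Qed.

Lemma holder_continuous (X : completeMetricType R) (f : X -> R) (l nu : R) :
  0 < l -> 0 < nu ->
  (forall x y, `|f x - f y| <= l * mdist x y `^ nu) -> continuous f.
Proof.
move=> l0 nu0 fl x; apply/cvgrPdist_le => /= e e0.
have [r r0 rP] := powR_small nu0 (divr_gt0 e0 l0).
apply/nbhs_ballP; exists r => //= y; rewrite ballEmdist /= => xy.
rewrite (le_trans (fl x y))// mulrC -ler_pdivlMr// ltW// rP//.
exact: mdist_ge0.
Qed.

(** Since phi >= u / (1 + u) and u >= D^nu: if D >= 1 this is at least 1/2, and otherwise D <= u
    gives D (1 + u) <= 2 u. *)
Lemma min_le_decay (p : nat) (K nu D : R) : 1 <= K -> 0 < nu <= 1 -> 0 <= D ->
  Num.min 2 D <= 4 * (1 - decay p.+1 (K * D `^ nu)).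
Proof.
move=> K1 /andP[nu0 nu1] D0.
set u := K * D `^ nu.
have Du : D `^ nu <= u by rewrite ler_peMl// powR_ge0.
have u0 : 0 <= u by apply: le_trans Du; exact: powR_ge0.
have dec : decay p.+1 u <= (1 + u)^-1.
  rewrite /decay exprS ler_piMr ?invr_ge0 ?addr_ge0// exprn_ile1 ?invr_ge0 ?addr_ge0//.
  by rewrite invf_le1 ?lerDl// ltr_pwDl.
have u1 : 0 < 1 + u by rewrite ltr_pwDl.
have E : 1 - (1 + u)^-1 = u / (1 + u) by field; rewrite gt_eqF.
apply: (@le_trans _ _ (4 * (u / (1 + u)))); last by rewrite -E; lra.
have [D1|D1] := leP 1 D.
  have : 1 <= u.
    apply: le_trans Du; have <- : 1 `^ nu = 1 :> R by rewrite powR1.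
    by apply: ge0_ler_powR; rewrite ?nnegrE// ltW.
  move=> u1'; apply: (@le_trans _ _ 2); first by rewrite ge_min lexx.
  by rewrite mulrA ler_pdivlMr//; lra.
have DD : D <= D `^ nu.
  have [->|Dn0] := eqVneq D 0; first exact: powR_ge0.
  by apply: ger1_powR => //; rewrite lt_neqAle eq_sym Dn0 D0 ltW.
rewrite ge_min; apply/orP; right.
rewrite mulrA ler_pdivlMr//.
have : D * (1 + u) = D + D * u by ring.
have : D * u <= 1 * u by rewrite ler_wpM2r// ltW.
by lra.
Qed.

Lemma le_decay_linear (p : nat) (u : R) : 0 <= u -> 1 - decay p u <= p%:R * u.
Proof.
move=> u0; have := decay_tangent p u0 (lexx 0).
by rewrite decay0 subr0 addr0 divr1 mul1r; lra.
Qed.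

End rho.

Theorem proposition3p1 (R : realType) (X : completeMetricType R)
  (X_separable : separable_space X)
  (d : measure_display) (Theta : measurableType d)
  (vartheta : X -> probability Theta R) (S : Theta -> X -> X)
  (S_continuous : forall theta : Theta, continuous (S theta))
  (S_measurable : measurable_fun [set: Theta * borel X]
    ((fun p => S p.1 p.2) : Theta * borel X -> borel X))
  (alpha : R) (alpha_itv : 0 < alpha < 1)
  (B1 : forall x y : X,
    (\int[vartheta x]_theta (mdist (S theta x) (S theta y))%:E
      <= (alpha * mdist x y)%:E)%E)
  (xbar : X)
  (B2 : (ereal_sup [set \int[vartheta x]_theta (mdist (S theta xbar) xbar)%:E
                   | x in [set: X]] < +oo)%E)
  (l nu : R) (l_gt0 : 0 < l) (nu_itv : 0 < nu <= 1)
  (B3 : forall x y : X,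
    (tv_norm (charge_diff (vartheta x) (vartheta y))
      <= (l * mdist x y `^ nu)%:E)%E)
  (delta : R) (delta_gt0 : 0 < delta)
  (B4 : forall x y : X, exists2 lam : {finite_measure set Theta -> \bar R},
    is_measure_meet (vartheta x) (vartheta y) lam &
    (delta%:E < lam [set theta | mdist (S theta x) (S theta y)
                                 <= alpha * mdist x y]%R)%E) :
  (forall f : X -> R, Bb f -> Bb (P_op vartheta S f)) /\
  exists mu_star : probability (borel X) R,
    [/\ invariant_measure vartheta S mu_star,
        forall mu : probability (borel X) R, invariant_measure vartheta S mu ->
          forall A : set (borel X), measurable A -> mu A = mu_star A,
        M11 mu_star,
        attractive_measure vartheta S mu_star &
        exists q C : R, [/\ 0 < q < 1, 0 < C &
          forall (mu : probability (borel X) R) (n : nat), M11 mu ->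
            (FM_dist (iter n (P_dual vartheta S) mu) mu_star
              <= (q ^+ n * C)%:E * (1 + \int[mu]_x (mdist xbar x)%:E))%E]].
Proof.
have /andP[nu0 nu1] := nu_itv; have /andP[a0 a1] := alpha_itv.
(* By (B3), x -> vartheta x A is Hölder continuous, hence Borel. *)
have vm (A : set Theta) : measurable A ->
    measurable_fun [set: borel X] ((fun x => vartheta x A) : borel X -> \bar R).
  move=> mA.
  have : measurable_fun [set: borel X] ((fun x => fine (vartheta x A)) : borel X -> R).
    apply: continuous_borel_measurable; apply: (holder_continuous l_gt0 nu0) => x y.
    exact: vartheta_tv.
  move=> /measurable_EFinP; apply: eq_measurable_fun => x _ /=.
  by rewrite fineK// fin_num_measure.
have BbE (f : X -> R) : Bb f <-> bmeas (f : borel X -> R).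
  split=> [[mf [M [_ fM]]]|[mf [M fM]]]; split=> //.
    by exists (`|M| + 1) => x; apply: fM => //; rewrite ltr_pwDr// ler_norm.
  by exists M; split; [exact: num_real|move=> N MN x _ /=; rewrite (le_trans (fM x))// ltW].
split=> [f /BbE bf|]; first by apply/BbE; exact: P_op_bmeas.
have [c c0 drift] := drift_bound X_separable S_measurable B1 B2.
have [p [K [eta [q [K1 eta0 q01 contr]]]]] := P_op_contraction X_separable S_measurable
  alpha_itv B1 B2 l_gt0 nu_itv B3 delta_gt0 B4.
pose phi (x y : X) := 1 - decay p.+1 (K * mdist x y `^ nu).
pose W (x y : X) := 1 + eta * (mdist xbar x + mdist xbar y).
have u0 (x y : X) : 0 <= K * mdist x y `^ nu.
  by rewrite mulr_ge0 ?powR_ge0// (le_trans ler01).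
have phi0 x y : 0 <= phi x y by rewrite subr_ge0 decay_le1.
have phi1 x y : phi x y <= 1 by rewrite gerBl ltW// decay_gt0.
have W1 x y : 1 <= W x y by rewrite lerDl mulr_ge0 ?addr_ge0 ?mdist_ge0// ltW.
have W0 x y : 0 <= W x y by apply: le_trans (W1 x y).
pose rho x y := Num.sqrt (phi x y * W x y).
have rhoC x y : rho x y = rho y x.
  by rewrite /rho /phi /W [mdist x y]metric_sym [mdist xbar x + _]addrC.
(* Because phi <= 1 <= W. *)
have phi_le x y : phi x y <= rho x y.
  rewrite -[leLHS]ger0_norm// -sqrtr_sqr ler_sqrt ?mulr_ge0//.
  by rewrite expr2 ler_wpM2l// (le_trans (phi1 x y) (W1 x y)).
apply: (@exponential_ergodicity R X X_separable d Theta vartheta S S_measurable vm xbar alpha c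
  alpha_itv c0 drift rho q eta q01 eta0 contr).
- move=> x y; rewrite (le_trans (min_le_decay p K1 nu_itv (mdist_ge0 x y)))//.
  by rewrite ler_wpM2l// phi_le.
- move=> x y; rewrite -/(W x y) -[leRHS]ger0_norm//.
  rewrite -sqrtr_sqr ler_sqrt ?sqr_ge0// expr2 ler_wpM2r//.
  exact: le_trans (phi1 x y) (W1 x y).
- move=> x e e0.
  (* A bound for W x y when d(x, y) < 1. Then rho^2 <= (p + 1) K d^nu B, which determines the
     radius. *)
  pose B := 1 + eta * (2 * mdist xbar x + 1).
  have B0 : 0 < B by rewrite ltr_pwDl// mulr_ge0 ?(ltW eta0)// addr_ge0// mulr_ge0// mdist_ge0.
  have K0 : 0 < K by apply: lt_le_trans K1.
  have C0 : 0 < p.+1%:R * K * B by rewrite !mulr_gt0.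
  have [r r0 rP] := powR_small nu0 (divr_gt0 (exprn_gt0 2 e0) C0).
  exists (Num.min r 1); first by rewrite lt_min r0 ltr01.
  move=> y; rewrite lt_min => /andP[xr x1].
  rewrite (rhoC y x); suff : rho x y < e by [].
  rewrite -[ltRHS]gtr0_norm// -sqrtr_sqr ltr_sqrt ?exprn_gt0//.
  have WB : W x y <= B.
    rewrite /W /B lerD2l ler_wpM2l ?(ltW eta0)//.
    by have := metric_triangle xbar x y; lra.
  apply: (@le_lt_trans _ _ (p.+1%:R * (K * mdist x y `^ nu) * B)).
    by apply: ler_pM => //; exact: le_decay_linear.
  have := rP _ (mdist_ge0 x y) xr; rewrite ltr_pdivlMr// => /le_lt_trans; apply.
  by rewrite le_eqVlt; apply/orP; left; apply/eqP; ring.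
Qed.
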